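(* Let $G$ be a 2-connected graph. If $G$ is $\{K_{1,3},W\}$-$f$-heavy, then $G$ is Hamiltonian.
   Context: All graphs are finite and simple. $d(v)$ denotes the degree of $v$ in $G$, and $d_{G'}(u,v)$ denotes the distance between $u$ and $v$ in a graph $G'$. A graph is Hamiltonian if it has a cycle through all its vertices. $f$-heavy: Let $G$ be a graph on $n$ vertices. For a given graph $H$, $G$ is $H$-$f$-heavy if for every induced subgraph $G'$ of $G$ isomorphic to $H$ and every two vertices $u,v\in V(G')$, $d_{G'}(u,v)=2$ implies $\max\{d(u),d(v)\}\geq n/2$ (degrees taken in $G$). For a family $\mathcal{H}$ of graphs, $G$ is $\mathcal{H}$-$f$-heavy if $G$ is $H$-$f$-heavy for every $H\in\mathcal{H}$. $K_{1,3}$ is the claw. $W$ (wounded) is the graph with vertices $a_1,a_2,a_3,b_1,b_2,c_1$ and edges $a_1a_2,a_2a_3,a_3a_1,a_1b_1,b_1c_1,a_2b_2$. *)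

(* Defs.v *)
From mathcomp Require Import all_boot.
Set Implicit Arguments. Unset Strict Implicit. Unset Printing Implicit Defensive.

Record sgraph := SGraph {
  vertex :> finType;
  adj : rel vertex;
  adj_sym : symmetric adj;
  adj_irrefl : irreflexive adj }.

Definition degree (G : sgraph) (x : G) : nat := #|[set y | adj x y]|.

Definition walk (G : sgraph) (x y : G) (p : seq G) : Prop :=
  path (@adj G) x p /\ last x p = y.

(* The list [p] omits the starting vertex, so [size p] is the length of the
   walk. As a relation, this leaves the distance between vertices of different
   components undefined (it holds for no [d]). *)
Definition dist_is (G : sgraph) (x y : G) (d : nat) : Prop :=
  (exists2 p, walk x y p & size p = d) /\
  (forall p, walk x y p -> d <= size p).

Section Induced.
Variables (G : sgraph) (S : {set G}).

Definition induced_adj : rel {x : G | x \in S} :=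
  [rel x y | adj (val x) (val y)].

Lemma induced_adj_sym : symmetric induced_adj.
Proof. by move=> x y; apply: adj_sym. Qed.

Lemma induced_adj_irrefl : irreflexive induced_adj.
Proof. by move=> x; apply: adj_irrefl. Qed.

Definition induced : sgraph := SGraph induced_adj_sym induced_adj_irrefl.
End Induced.

Definition isomorphic (G H : sgraph) : Prop :=
  exists2 f : G -> H, bijective f & forall x y, adj (f x) (f y) = adj x y.

Definition connected (G : sgraph) : Prop := forall x y : G, connect (@adj G) x y.

Definition k_connected (k : nat) (G : sgraph) : Prop :=
  k < #|G| /\ forall S : {set G}, #|S| < k -> connected (induced (~: S)).

(* [ucycle] accepts closed sequences of length 2 (a traversed edge), which are
   not cycles of a simple graph, hence the bound on the size. *)
Definition hamiltonian (G : sgraph) : Prop :=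
  exists p : seq G, [/\ 2 < size p, ucycle (@adj G) p & forall x, x \in p].

(* The bound [max {d(u), d(v)} >= n / 2] is cleared of its denominator. *)
Definition f_heavy (H G : sgraph) : Prop :=
  forall S : {set G}, isomorphic (induced S) H ->
  forall u v : induced S, dist_is u v 2 ->
  #|G| <= 2 * maxn (degree (val u)) (degree (val v)).

Definition family_f_heavy (HH : sgraph -> Prop) (G : sgraph) : Prop :=
  forall H : sgraph, HH H -> f_heavy H G.

Section EdgeList.
Variables (n : nat) (E : seq (nat * nat)).

Definition edges_adj : rel 'I_n :=
  [rel x y : 'I_n | (x != y) &&
     (((val x, val y) \in E) || ((val y, val x) \in E))].

Lemma edges_adj_sym : symmetric edges_adj.
Proof. by move=> x y; rewrite /edges_adj /= eq_sym orbC. Qed.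

Lemma edges_adj_irrefl : irreflexive edges_adj.
Proof. by move=> x; rewrite /edges_adj /= eqxx. Qed.

Definition graph_of_edges : sgraph := SGraph edges_adj_sym edges_adj_irrefl.
End EdgeList.

Definition claw : sgraph := graph_of_edges 4 [:: (0, 1); (0, 2); (0, 3)].

(* Vertices: a1 = 0, a2 = 1, a3 = 2, b1 = 3, b2 = 4, c1 = 5. *)
Definition wounded : sgraph :=
  graph_of_edges 6 [:: (0, 1); (1, 2); (2, 0); (0, 3); (3, 5); (1, 4)].

(* Main.v *)
Require Import Defs.
From mathcomp Require Import all_boot zify.
Set Implicit Arguments. Unset Strict Implicit. Unset Printing Implicit Defensive.

(** Call a vertex heavy when its degree is at least n / 2.  By the Bondy-Chvatal
    argument heavy vertices may be treated as pairwise adjacent, and then any three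
    neighbours of a vertex contain an adjacent pair.  Take a longest cycle C among
    those through all heavy vertices, suppose that it misses a vertex, and let w be
    a shortest path outside C joining two vertices v and u of C.  Induced wounded
    graphs with their long arm running towards w show that the distance classes of
    v inside C are cliques, with consecutive classes completely joined, as long as
    they contain light vertices.  Therefore turning the union of these classes into
    a clique creates no longer cycle, and the classes go on until one is reached in
    which all vertices are heavy.  The same holds at u, and the adjacency of the
    heavy vertices reached from v and from u allows an exchange of edges on C that
    produces a longer cycle through w. *)

(** * Paths as sequences with prescribed ends *)

(** All vertices off C are light, because C runs through every heavy vertex; so a closure pair at
    such a vertex is an edge of G, and a disjunction of heaviness involving it is decided. Induced
    subgraphs have to be found in G, while exchanges on C use an enlarged relation. Nonadjacency is
    therefore mostly proved in the enlarged relation, which contains G, and adjacency at light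
    vertices, where the closure adds nothing. Maximality of C is stated only against cycles with
    vertices in C and w: a vertex of a distance class may have further neighbours elsewhere, which
    nothing controls. That w is shortest keeps the first arm (v and its next two vertices towards u)
    induced. If w is a single vertex, this arm ends at u itself, and chords between neighbours of v
    and neighbours of u have to be treated apart. If u or v is heavy, one side suffices, since the
    heavy vertex reached from the other end would be joined to it. If both are light, the clique at
    u is built on top of the one at v; the set F records the pairs already added, to show that they
    do not interfere. *)

Section Seg.
Variable T : eqType.
Implicit Types (e : rel T) (s t c : seq T) (x y a b : T).

(** Unlike in [path], the list contains its first vertex and both ends are recorded, so that pieces
    of a cycle can be reversed and concatenated freely. The empty list is never a segment. *)
Definition seg e s x y :=
  if s is a :: p then [&& a == x, path e a p & last a p == y] else false.

Lemma seg1 e x : seg e [:: x] x x.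
Proof. by rewrite /= !eqxx. Qed.

Lemma seg_cat e s t x y a b :
  seg e s x y -> e y a -> seg e t a b -> seg e (s ++ t) x b.
Proof.
case: s => [|c s] //= /and3P[/eqP-> es /eqP<-] eya.
case: t => [|d t] //= /and3P[/eqP-> et /eqP<-].
by rewrite eqxx cat_path es /= eya et last_cat /= eqxx.
Qed.

Lemma seg_cons e s x a b : e x a -> seg e s a b -> seg e (x :: s) x b.
Proof. by move=> exa; apply: (@seg_cat e [:: x] s x x a b (seg1 e x)). Qed.

Lemma seg_consE e s x y a b : seg e (a :: b :: s) x y ->
  [/\ a = x, e a b & seg e (b :: s) b y].
Proof.
by move=> /and3P[/eqP-> /andP[eb es] el]; split => //; apply/and3P.
Qed.

Lemma seg_catE e s t x y : s <> [::] -> t <> [::] -> seg e (s ++ t) x y ->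
  exists a b, [/\ seg e s x a, e a b & seg e t b y].
Proof.
case: s => // a s _; case: t => // b t _ /=.
rewrite cat_path last_cat /= => /and3P[/eqP-> /and3P[es eb et] /eqP<-].
by exists (last x s), b; split; rewrite ?eqxx //= ?eqxx ?es ?et.
Qed.

Lemma seg_rev e s x y : symmetric e -> seg e s x y -> seg e (rev s) y x.
Proof.
move=> esym; elim: s x => [|a [|b s] IH] x //.
  by rewrite /= => /andP[/eqP-> /eqP<-]; rewrite eqxx.
move=> /seg_consE[<- eab /IH es]; rewrite rev_cons -cats1.
by apply: seg_cat es _ (seg1 _ _); rewrite esym.
Qed.

Lemma seg_sub e e' s x y :
  {in s &, forall a b, e a b -> e' a b} -> seg e s x y -> seg e' s x y.
Proof.
case: s => //= a s sub /and3P[-> es ->]; rewrite /= andbT.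
by apply: (@sub_in_path _ (mem (a :: s)) e e' sub) => //; apply/allP.
Qed.

Lemma seg_subrel e e' s x y : subrel e e' -> seg e s x y -> seg e' s x y.
Proof. by move=> sub; apply: seg_sub => a b _ _; apply: sub. Qed.

Lemma seg_head e s x y : seg e s x y -> x \in s.
Proof. by case: s => //= a s /and3P[/eqP-> _ _]; rewrite inE eqxx. Qed.

Lemma seg_last e s x y : seg e s x y -> y \in s.
Proof. by case: s => //= a s /and3P[_ _ /eqP<-]; rewrite mem_last. Qed.

Lemma seg_headE e s x y : seg e s x y -> exists s', s = x :: s'.
Proof. by case: s => //= a s /and3P[/eqP-> _ _]; exists s. Qed.

Lemma seg_lastE e s x y : seg e s x y -> exists s', s = rcons s' y.
Proof. by case: s => //= a s /and3P[_ _ /eqP<-]; exists (belast a s); rewrite lastI. Qed.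

Lemma seg_n0 e s x y : seg e s x y -> s <> [::].
Proof. by case: s. Qed.

Lemma path_seg e x p : path e x p -> seg e (x :: p) x (last x p).
Proof. by rewrite /= !eqxx => ->. Qed.

Lemma seg_size1 e s x : uniq s -> seg e s x x -> s = [:: x].
Proof.
case: s => //= a s /andP[nas _] /and3P[/eqP ax _ /eqP la]; move: nas.
case: s la => [_ _|b s /= lb]; first by rewrite ax.
by rewrite ax -lb mem_last.
Qed.

Definition addp e a b : rel T :=
  fun x y => [|| e x y, (x == a) && (y == b) | (x == b) && (y == a)].

Lemma addp_sym e a b : symmetric e -> symmetric (addp e a b).
Proof.
move=> esym x y; rewrite /addp esym; congr (_ || _).
by rewrite orbC [in X in X || _]andbC [in X in _ || X]andbC.
Qed.

Lemma addp_or e a b x y : addp e a b x y ->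
  [\/ e x y, x = a /\ y = b | x = b /\ y = a].
Proof.
by case/or3P=> [h|/andP[/eqP-> /eqP->]|/andP[/eqP-> /eqP->]];
  [constructor 1|constructor 2|constructor 3].
Qed.

(** Without repeated vertices the new pair is traversed at most once; cutting there leaves two
    segments of [e]. *)
Lemma seg_addp e a b c x y : uniq c -> seg (addp e a b) c x y ->
  seg e c x y \/
  exists s t, c = s ++ t /\ (seg e s x a && seg e t b y \/ seg e s x b && seg e t a y).
Proof.
elim: c x => [|u [|v c] IH] x //.
  by rewrite /= => _ /andP[/eqP-> /eqP->]; left; rewrite eqxx.
move=> /andP[nu uc] /seg_consE[<- /addp_or euv /(IH _ uc) hs].
case: euv => [euv|[ua vb]|[ub va]].
- case: hs => [h|[s [t [cE hst]]]]; first by left; apply: seg_cons h.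
  right; exists (u :: s), t; split; first by rewrite cE.
  case: hst => /andP[h1 h2]; [left|right]; rewrite h2 andbT;
  by apply: seg_cons h1.
- case: hs => [h|[s [t [cE hst]]]].
    right; exists [:: u], (v :: c); split=> //; left.
    by rewrite ua seg1 -vb.
  by case: hst nu => /andP[h1 h2]; rewrite cE mem_cat -ua in h1 h2 *;
   rewrite ?(seg_last h1) ?(seg_head h2) ?orbT.
- case: hs => [h|[s [t [cE hst]]]].
    right; exists [:: u], (v :: c); split=> //; right.
    by rewrite ub seg1 -va.
  by case: hst nu => /andP[h1 h2]; rewrite cE mem_cat -ub in h1 h2 *;
   rewrite ?(seg_last h1) ?(seg_head h2) ?orbT.
Qed.

Lemma uniq_cat_disj (s t : seq T) x : uniq (s ++ t) -> x \in s -> x \in t -> False.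
Proof.
by rewrite cat_uniq => /and3P[_ /hasPn h _] xs xt; move: (h _ xt); rewrite xs.
Qed.

(** A cycle through the new pair, opened at that pair, is a path from [a] to [b] on the same
    vertices. The size bound excludes the closed walk that runs along the new pair twice. *)
Lemma cycle_addp e a b c x y : symmetric e -> uniq c -> 2 < size c ->
  seg (addp e a b) c x y -> addp e a b y x ->
  (exists x' y', seg e c x' y' /\ e y' x') \/
  exists2 q, perm_eq q c & seg e q a b.
Proof.
move=> esym uc c2 /(seg_addp uc)[h|[s [t [cE hst]]]] /addp_or[eyx|[ya xb]|[yb xa]].
- by left; exists x, y.
- by right; exists (rev c); rewrite ?perm_rev // -ya -xb; apply: seg_rev.
- by right; exists c => //; rewrite -yb -xa.
- right; case: hst => /andP[h1 h2].
    exists (rev (t ++ s)).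
      by rewrite (perm_trans _ (_ : perm_eq (t ++ s) _)) ?perm_rev // cE perm_catC.
    by apply: seg_rev => //; apply: seg_cat h2 eyx h1.
  exists (t ++ s); first by rewrite cE perm_catC.
  by apply: seg_cat h2 eyx h1.
- case: hst => /andP[h1 h2]; rewrite cE in uc c2.
    by case: (uniq_cat_disj uc (seg_last h1)); rewrite -ya (seg_last h2).
  move: (uc); rewrite cat_uniq => /and3P[us _ ut].
  rewrite -xb in h1; rewrite ya in h2.
  by rewrite (seg_size1 us h1) (seg_size1 ut h2) in c2.
- case: hst => /andP[h1 h2]; rewrite cE in uc c2.
    move: (uc); rewrite cat_uniq => /and3P[us _ ut].
    rewrite -xa in h1; rewrite yb in h2.
    by rewrite (seg_size1 us h1) (seg_size1 ut h2) in c2.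
  by case: (uniq_cat_disj uc (seg_last h1)); rewrite -yb (seg_last h2).
Qed.

End Seg.

Lemma mem_split (T : eqType) (s : seq T) x : x \in s -> exists s1 s2, s = s1 ++ x :: s2.
Proof. by case/splitPr=> s1 s2; exists s1, s2. Qed.

Lemma split_prefix (T : eqType) (P : pred T) (s : seq T) x : x \in s -> ~~ P x ->
  exists s1 y s2, [/\ s = s1 ++ y :: s2, all P s1 & ~~ P y].
Proof.
elim: s => // a s IH; rewrite inE; have [Pa|nPa] := boolP (P a); last first.
  by exists [::], a, s.
case/orP=> [/eqP->|xs nPx]; first by rewrite Pa.
have [s1 [y [s2 [-> h1 h2]]]] := IH xs nPx.
by exists (a :: s1), y, s2; rewrite /= Pa.
Qed.

Lemma seg_eq (T : eqType) (e e' : rel T) s x y x' y' :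
  seg e s x y -> seg e' s x' y' -> x = x' /\ y = y'.
Proof. by case: s => // a s /and3P[/eqP<- _ /eqP<-] /and3P[/eqP<- _ /eqP<-]. Qed.

(** * Heavy vertices *)

Section Heavy.
Variable G : sgraph.
Implicit Types (x y z c : G).

Definition heavy x := #|G| <= 2 * degree x.

Definition hadj : rel G := fun x y => adj x y || [&& x != y, heavy x & heavy y].

Lemma adj_neq x y : adj x y -> x != y.
Proof. by case: eqP => // ->; rewrite adj_irrefl. Qed.

Lemma adjC x y : adj x y = adj y x.
Proof. exact: adj_sym. Qed.

Lemma hadj_sym : symmetric hadj.
Proof. by move=> x y; rewrite /hadj adjC eq_sym [heavy x && _]andbC. Qed.

Lemma hadj_neq x y : hadj x y -> x != y.
Proof. by case/orP=> [/adj_neq|/andP[]]. Qed.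

Lemma adj_hadj : subrel (@adj G) hadj.
Proof. by move=> x y h; rewrite /hadj h. Qed.

Lemma heavy_hadj x y : x != y -> heavy x -> heavy y -> hadj x y.
Proof. by move=> xy hx hy; rewrite /hadj xy hx hy orbT. Qed.

Lemma hadj_light x y : ~~ heavy x -> hadj x y -> adj x y.
Proof. by move=> /negbTE lx; rewrite /hadj lx andbF orbF. Qed.

Lemma f_heavy_copy (H : sgraph) (g : H -> G) : f_heavy H G -> injective g ->
    (forall i j, adj (g i) (g j) = adj i j) ->
  forall i j k, i != j -> ~~ adj i j -> adj i k -> adj k j ->
  heavy (g i) || heavy (g j).
Proof.
move=> fH ginj gadj i j k ij nij ik kj; pose S := [set g i | i in [set: H]].
have gS i' : g i' \in S by apply: imset_f.
pose h i' : induced S := exist _ (g i') (gS i').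
have hb : bijective h.
  apply: inj_card_bij => [a b /(congr1 val)|]; first exact: ginj.
  by rewrite card_sig (eq_card (_ : _ =i S)) // -cardsT; apply: leq_imset_card.
have iso : isomorphic (induced S) H.
  case: hb => f hK fK; exists f; first by exists h.
  by move=> x y; rewrite -[in RHS](fK x) -[in RHS](fK y) /= -gadj.
have d2 : dist_is (h i) (h j) 2.
  split; first by exists [:: h k; h j] => //; split; rewrite //= /induced_adj /= !gadj ik kj.
  case=> [|a [|b p]] [] //=.
    by move=> _ /(congr1 val)/ginj/eqP; rewrite (negbTE ij).
  by rewrite andbT => + aj; rewrite aj /induced_adj /= gadj (negbTE nij).
by have := fH S iso (h i) (h j) d2; rewrite /heavy maxnMr leq_max.
Qed.

(** If the three neighbours are independent, every two of them include a heavy one, so at least two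
    are heavy and form a closure pair. *)
Lemma claw_hadj : f_heavy claw G -> forall c x y z,
  adj c x -> adj c y -> adj c z -> x != y -> x != z -> y != z ->
  [|| hadj x y, hadj x z | hadj y z].
Proof.
move=> fc c x y z cx cy cz xy xz yz; rewrite /hadj xy xz yz /=.
case axy: (adj x y) => //=; case axz: (adj x z); rewrite ?orbT //=.
case ayz: (adj y z); rewrite ?orbT //=.
have [xc yc zc] : [/\ adj x c, adj y c & adj z c] by rewrite ![adj _ c]adjC.
have [yx zx zy] : [/\ adj y x = false, adj z x = false & adj z y = false].
  by rewrite ![adj z _]adjC adjC.
pose g (i : claw) := nth c [:: c; x; y; z] (val i).
have ginj : injective g.
  move=> i j gij; apply/val_inj/eqP.
  rewrite -(@nth_uniq _ c [:: c; x; y; z]) ?ltn_ord //; first exact/eqP.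
  by rewrite /= !inE !negb_or xy xz yz !adj_neq.
have gadj (i j : claw) : adj (g i) (g j) = adj i j.
  by case: i => [[|[|[|[|]]]]] //= ?; case: j => [[|[|[|[|]]]]] //= ?; rewrite /g /= ?adj_irrefl.
have o (k : nat) (hk : k < 4) : claw := Ordinal hk.
have hh := f_heavy_copy fc ginj gadj.
have := hh (@Ordinal 4 1 isT) (@Ordinal 4 2 isT) (@Ordinal 4 0 isT) isT isT isT isT.
have := hh (@Ordinal 4 1 isT) (@Ordinal 4 3 isT) (@Ordinal 4 0 isT) isT isT isT isT.
have := hh (@Ordinal 4 2 isT) (@Ordinal 4 3 isT) (@Ordinal 4 0 isT) isT isT isT isT.
by rewrite /g /=; case: (heavy x); case: (heavy y); case: (heavy z).
Qed.

(** The pairs at distance two form a chain [c1], [a1], [b2], [a3], [b1], [a2]. A light vertex of the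
    chain thus forces its neighbours in the chain to be heavy; all applications use it in this
    way. *)
Lemma wounded_heavy : f_heavy wounded G -> forall a1 a2 a3 b1 c1 b2,
  adj a1 a2 -> adj a2 a3 -> adj a1 a3 -> adj a1 b1 -> adj b1 c1 -> adj a2 b2 ->
  ~~ adj a1 b2 -> ~~ adj a1 c1 -> ~~ adj a2 b1 -> ~~ adj a2 c1 -> ~~ adj a3 b1 ->
  ~~ adj a3 b2 -> ~~ adj a3 c1 -> ~~ adj b1 b2 -> ~~ adj b2 c1 ->
  [/\ heavy c1 || heavy a1, heavy a1 || heavy b2, heavy b2 || heavy a3,
      heavy a3 || heavy b1 & heavy b1 || heavy a2].
Proof.
move=> fw a1 a2 a3 b1 c1 b2 e1 e2 e3 e4 e5 e6 n1 n2 n3 n4 n5 n6 n7 n8 n9.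
pose l := [:: a1; a2; a3; b1; b2; c1].
pose g (i : wounded) := nth a1 l (val i).
have gadj (i j : wounded) : adj (g i) (g j) = adj i j.
  move: n1 n2 n3 n4 n5 n6 n7 n8 n9 => /negbTE n1 /negbTE n2 /negbTE n3 /negbTE n4
    /negbTE n5 /negbTE n6 /negbTE n7 /negbTE n8 /negbTE n9.
  by case: i => [[|[|[|[|[|[|]]]]]]] //= ?; case: j => [[|[|[|[|[|[|]]]]]]] //= ?;
    rewrite /g /= ?adj_irrefl ?n1 ?n2 ?n3 ?n4 ?n5 ?n6 ?n7 ?n8 ?n9 //
    adjC ?n1 ?n2 ?n3 ?n4 ?n5 ?n6 ?n7 ?n8 ?n9 ?e1 ?e2 ?e3 ?e4 ?e5 ?e6.
(* No two vertices of [wounded] have the same neighbours, so distinctness follows from the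
   adjacencies alone. *)
have ginj : injective g.
  move=> i j gij; have row k : adj i k = adj j k by rewrite -!gadj gij.
  have := (row (@Ordinal 6 0 isT), row (@Ordinal 6 1 isT), row (@Ordinal 6 2 isT),
           row (@Ordinal 6 3 isT), row (@Ordinal 6 4 isT), row (@Ordinal 6 5 isT)).
  move: i j {gij row}.
  case=> [[|[|[|[|[|[|]]]]]]] //= ?; case=> [[|[|[|[|[|[|]]]]]]] //= ?;
    by case=> [[[[[]]]]] //= *; apply/val_inj.
have hh := f_heavy_copy fw ginj gadj.
have := hh (@Ordinal 6 5 isT) (@Ordinal 6 0 isT) (@Ordinal 6 3 isT) isT isT isT isT.
have := hh (@Ordinal 6 0 isT) (@Ordinal 6 4 isT) (@Ordinal 6 1 isT) isT isT isT isT.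
have := hh (@Ordinal 6 4 isT) (@Ordinal 6 2 isT) (@Ordinal 6 1 isT) isT isT isT isT.
have := hh (@Ordinal 6 2 isT) (@Ordinal 6 3 isT) (@Ordinal 6 0 isT) isT isT isT isT.
by have := hh (@Ordinal 6 3 isT) (@Ordinal 6 1 isT) (@Ordinal 6 0 isT) isT isT isT isT.
Qed.
End Heavy.

(** * Bondy-Chvatal closure for heavy pairs *)

Section Ore.

(** Pigeonhole on the consecutive pairs of the path: [P] marks a pair by its second vertex, [R] by
    its first, and there are more marks than pairs. *)
Lemma count_crossing (T : eqType) (P R : pred T) x p :
  size p < count P p + count R (belast x p) ->
  exists s1 u w s2, [/\ x :: p = s1 ++ u :: w :: s2, P w & R u].
Proof.
elim: p x => [|y p IH] x //= lt.
have [/andP[Py Rx]|nPR] := boolP (P y && R x); first by exists [::], x, y, p.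
have [|s1 [u [w [s2 [E Pw Ru]]]]] := IH y.
  by move: nPR lt; case: (P y) => /=; case: (R x) => //=; lia.
by exists (x :: s1), u, w, s2; rewrite E.
Qed.

Variable G : sgraph.
Implicit Types (x y a b : G) (q c : seq G) (e : rel G).

Lemma card_in_out q (P : pred G) : uniq q ->
  #|[set y | P y]| = count P q + #|[set y | P y & y \notin q]|.
Proof.
move=> uq; rewrite -(cardsID [set y in q]); congr (_ + _); last first.
  by apply: eq_card => y; rewrite !inE andbC.
rewrite -size_filter -(card_uniqP (filter_uniq P uq)).
by apply: eq_card => y; rewrite !inE mem_filter.
Qed.

(** The degrees of [a] and [b] add up to at least [#|G|]. A common neighbour off the path closes it
    up; otherwise their neighbours off the path are disjoint, and those on the path are numerous
    enough to give two crossing chords. *)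
Lemma ore_step e a b q : subrel (@adj G) e -> symmetric e ->
    heavy a -> heavy b -> uniq q -> seg e q a b ->
  exists c x y, [/\ seg e c x y, e y x, uniq c & {subset q <= c}].
Proof.
move=> sub esym ha hb uq sq.
have [/existsP[m /and3P[mq am mb]]|/existsPn nout] :=
  boolP [exists m, [&& m \notin q, adj a m & adj m b]].
  exists (rcons q m), a, m; split.
  - by rewrite -cats1; apply: seg_cat sq _ (seg1 _ _); apply: sub; rewrite adj_sym.
  - by apply: sub; rewrite adj_sym.
  - by rewrite rcons_uniq mq.
  - by move=> z zq; rewrite mem_rcons inE zq orbT.
have [p qE] := seg_headE sq; subst q.
have lp : last a p = b by case/and3P: sq => _ _ /eqP.
have [|s1 [u [w [s2 [E aw bu]]]]] := @count_crossing _ (adj a) (adj b) a p.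
  have da := card_in_out (adj a) uq; have db := card_in_out (adj b) uq.
  have cb : count (adj b) (a :: p) = count (adj b) (belast a p).
    by rewrite lastI lp -cats1 count_cat /= adj_irrefl !addn0.
  rewrite {}cb in db.
  rewrite /= adj_irrefl add0n in da.
  have: #|[set y | adj a y & y \notin a :: p] :|: [set y | adj b y & y \notin a :: p]|
      <= #|~: [set y in a :: p]|.
    apply/subset_leq_card/subsetP => y.
    by rewrite !inE; case/orP=> /andP[].
  rewrite cardsU (_ : _ :&: _ = set0); last first.
    apply/setP => y; rewrite !inE; apply/negP => /andP[/andP[ay ny] /andP[by_ _]].
    by have := nout y; rewrite inE ny ay adj_sym by_.
  have := cardsC [set y in a :: p].
  rewrite cardsE (card_uniqP uq) cards0 /=.
  move: ha hb; rewrite /heavy /degree da db.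
  move: (#|[set y | adj a y & _]|) (#|[set y | adj b y & _]|) (#|~: _|) #|G|.
  by move=> ? ? ? ?; lia.
have sE : a :: p = rcons s1 u ++ (w :: s2) by rewrite cat_rcons.
rewrite sE in sq uq *; case: (seg_catE _ _ sq) => // [|u' [w' [s1g _ s2g]]]; first by case: (s1).
have uu : u' = u by case: (s1) s1g => [|? ?] /and3P[_ _ /eqP<-] //=; rewrite last_rcons.
have ww : w' = w by case/and3P: s2g => /eqP->.
exists (rcons s1 u ++ rev (w :: s2)), a, w; split.
- rewrite {}ww {}uu in s1g s2g; apply: seg_cat s1g _ (seg_rev esym s2g).
  by apply: sub; rewrite adj_sym.
- by apply: sub; rewrite adj_sym.
- by rewrite (perm_uniq (_ : perm_eq _ (rcons s1 u ++ w :: s2))) // perm_cat2l perm_rev.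
- by move=> z; rewrite !mem_cat mem_rev.
Qed.

(* Bondy-Chvatal closure: the heavy pairs are added one at a time and removed again by [ore_step]. *)
Lemma hadj_cycle c x y : seg (@hadj G) c x y -> hadj y x -> uniq c -> 2 < size c ->
  exists c' x' y', [/\ seg (@adj G) c' x' y', adj y' x', uniq c' & {subset c <= c'}].
Proof.
pose add (l : seq (G * G)) : rel G := foldr (fun p e => addp e p.1 p.2) (@adj G) l.
pose l := [seq p <- enum [set: G * G] | heavy p.1 & heavy p.2].
have hl : all (fun p => heavy p.1 && heavy p.2) l by exact: filter_all.
have sub : subrel (@hadj G) (add l).
  move=> u w /orP[|/and3P[_ hu hw]].
    by elim: (l) u w => //= p l' IH u w /IH h; rewrite /addp h.
  have: (u, w) \in l by rewrite mem_filter /= hu hw mem_enum inE.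
  elim: (l) => //= p l' IH; rewrite inE => /orP[/eqP<-|/IH h]; first by rewrite /addp /= !eqxx orbT.
  by rewrite /addp h.
move=> cs cyx uc c2.
have {cs cyx}: seg (add l) c x y /\ add l y x by split; [exact: seg_subrel sub cs|exact: sub].
elim: l hl c x y uc c2 {sub} => [_|[a b] l IH /= /andP[/andP[ha hb] hl]] c x y uc c2 [cs cyx].
  by exists c, x, y; split.
have add_sym : symmetric (add l).
  by elim: (l) => [|p l' IHl]; [exact: adj_sym | exact: addp_sym].
have add_adj : subrel (@adj G) (add l).
  by elim: (l) => // p l' IHl u w /IHl h; rewrite /= /addp h.
case: (cycle_addp add_sym uc c2 cs cyx) => [[x' [y' h]]|[q qc sq]]; first exact: IH h.
have [c' [x' [y' [s1 s2 s3 s4]]]] := ore_step add_adj add_sym ha hb (etrans (perm_uniq qc) uc) sq.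
have [|c'' [x'' [y'' [t1 t2 t3 t4]]]] := IH hl c' x' y' s3 _ (conj s1 s2).
  rewrite (leq_trans c2) // -(perm_size qc); apply: uniq_leq_size s4.
  by rewrite (perm_uniq qc).
exists c'', x'', y''; split=> // z zc; apply/t4/s4.
by rewrite (perm_mem qc).
Qed.
End Ore.

Ltac perm_by_count :=
  apply/permP => ?; do 3! [rewrite ?(count_cat, count_rev) /=]; clear; lia.

(** * Adding edges without creating longer cycles *)

Section Insertion.
Variables (T : eqType) (e : rel T).
Hypothesis esym : symmetric e.
Implicit Types (q A D : seq T).

Definition cyclic q := exists c x y, [/\ seg e c x y, e y x & perm_eq c q].

Let cyc c q x y : seg e c x y -> e y x -> perm_eq c q -> cyclic q.
Proof. by move=> *; exists c, x, y. Qed.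

Lemma split_mem_seg q a b x : seg e q a b -> x \in q -> x != a -> x != b ->
  exists A D a' b', [/\ q = A ++ x :: D, seg e A a a', e a' x, e x b' & seg e D b' b].
Proof.
move=> sq xq xa xb; case/splitPr: xq sq => A D sq; exists A, D.
have A0 : A <> [::] by move=> A0; move: sq xa; rewrite A0 /= => /andP[/eqP->]; rewrite eqxx.
case: (seg_catE A0 _ sq) => // a' [y [sA eax sx]].
have yx : y = x by case/andP: sx => /eqP->.
rewrite yx in eax sx; case: D sx {sq} => [|d D] sx.
  by move: sx xb; rewrite /= => /andP[_ /eqP->]; rewrite eqxx.
by have [_ exd sd] := seg_consE sx; exists a', d.
Qed.

(** If [x1] is joined to a path neighbour of [x2], it can be moved next to it. If not, the last
    hypothesis joins the two path neighbours of [x2], so that [x2] can be taken out and put between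
    [a] and [b]. *)
Lemma insert_left A D a b a' b' x1 x2 (q := A ++ x1 :: D) :
    uniq q -> seg e A a a' -> e a' x1 -> e x1 b' -> seg e D b' b ->
    e x1 a -> e x1 b -> (a' = a \/ e a' a) -> (b' = b \/ e b' b) ->
    x2 \in A -> x2 != a -> e x2 a -> e x2 b ->
    {in q &, forall p p', e x2 p -> e x2 p' -> p != p' -> p != x1 -> p' != x1 ->
      ~~ e x1 p -> ~~ e x1 p' -> e p p'} ->
  cyclic q.
Proof.
move=> uq sA ea1 e1b sD e1a eb1 aa bb xA xa e2a e2b Hb.
have [x2a'|nx2a'] := eqVneq x2 a'.
  apply: (@cyc (A ++ rev D ++ [:: x1]) _ a x1); [|by []|by rewrite /q; perm_by_count].
  apply: seg_cat sA _ (seg_cat (seg_rev esym sD) _ (seg1 _ _)); last by rewrite esym.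
  by rewrite -x2a'.
have [A1 [A2 [l1 [r1 [AE sA1 el er sA2]]]]] := split_mem_seg sA xA xa nx2a'.
have {}aa : e a' a.
  case: aa => // aa; move: uq; rewrite /q AE -catA => uq.
  by case: (uniq_cat_disj uq (seg_head sA1)); rewrite mem_cat inE -aa (seg_last sA2) orbT.
have [e1r|n1r] := boolP (e x1 r1).
  apply: (@cyc (A1 ++ [:: x2] ++ rev D ++ [:: x1] ++ A2) _ a a');
    [|by []|by rewrite /q AE; perm_by_count].
  apply: seg_cat sA1 el (seg_cat (seg1 _ _) e2b _).
  apply: seg_cat (seg_rev esym sD) _ (seg_cat (seg1 _ _) e1r sA2).
  by rewrite esym.
have [e1l|n1l] := boolP (e x1 l1).
  apply: (@cyc ((x2 :: A2) ++ A1 ++ [:: x1] ++ D) _ x2 b);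
    [|by rewrite esym|by rewrite /q AE; perm_by_count].
  apply: seg_cat (seg_cons er sA2) aa (seg_cat sA1 _ (seg_cat (seg1 _ _) e1b sD)).
  by rewrite esym.
have l1q : l1 \in q by rewrite /q AE !mem_cat (seg_last sA1).
have r1q : r1 \in q by rewrite /q AE !mem_cat inE (seg_head sA2) !orbT.
have elr : e l1 r1.
  apply: Hb => //; first by rewrite esym.
  - apply/eqP => lr; move: uq; rewrite /q AE -catA => uq.
    case: (uniq_cat_disj uq (seg_last sA1)).
    by rewrite lr mem_cat inE (seg_head sA2) orbT.
  - apply/eqP => lr; case: (uniq_cat_disj uq (x := x1)); rewrite ?inE ?eqxx //.
    by rewrite -lr AE mem_cat (seg_last sA1).
  - apply/eqP => lr; case: (uniq_cat_disj uq (x := x1)); rewrite ?inE ?eqxx //.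
    by rewrite -lr AE mem_cat inE (seg_head sA2) !orbT.
apply: (@cyc ([:: x1] ++ rev A2 ++ rev A1 ++ [:: x2] ++ rev D) _ x1 b');
  [|by rewrite esym|by rewrite /q AE; perm_by_count].
have e1a' : e x1 a' by rewrite esym.
have erl : e r1 l1 by rewrite esym.
have ea2 : e a x2 by rewrite esym.
apply: seg_cat (seg1 _ _) e1a' (seg_cat (seg_rev esym sA2) erl _).
by apply: seg_cat (seg_rev esym sA1) ea2 (seg_cat (seg1 _ _) e2b (seg_rev esym sD)).
Qed.

(* Two adjacent common neighbours x1, x2 of the ends of a spanning path close it
   up, as soon as x1 has no neighbour away from both ends and the neighbours of
   x2 away from x1 form a clique. *)
Lemma close_path q a b x1 x2 : uniq q -> seg e q a b ->
    x1 \in q -> x2 \in q -> x1 != a -> x1 != b -> x2 != a -> x2 != b -> x1 != x2 ->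
    e x1 a -> e x1 b -> e x2 a -> e x2 b ->
    {in q, forall p, e x1 p -> [\/ p = a, p = b, e p a | e p b]} ->
    {in q &, forall p p', e x2 p -> e x2 p' -> p != p' -> p != x1 -> p' != x1 ->
      ~~ e x1 p -> ~~ e x1 p' -> e p p'} ->
  cyclic q.
Proof.
move=> uq sq q1 q2 x1a x1b x2a x2b x12 e1a e1b e2a e2b Ha Hb.
have [A [D [a' [b' [qE sA ea' eb' sD]]]]] := split_mem_seg sq q1 x1a x1b.
have db : e b' a -> cyclic q.
  move=> ba; apply: (@cyc (A ++ [:: x1] ++ rev D) _ a b'); [|by []|by rewrite qE; perm_by_count].
  by apply: seg_cat sA _ (seg_cat (seg1 _ _) e1b (seg_rev esym sD)).
have da : e a' b -> cyclic q.
  move=> ab; apply: (@cyc (A ++ rev D ++ [:: x1]) _ a x1); [|by []|by rewrite qE; perm_by_count].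
  by apply: seg_cat sA ab (seg_cat (seg_rev esym sD) _ (seg1 _ _)); rewrite esym.
have a'q : a' \in q by rewrite qE mem_cat (seg_last sA).
have b'q : b' \in q by rewrite qE mem_cat inE (seg_head sD) !orbT.
have disj y : y \in A -> y \in D -> False.
  by move=> yA yD; rewrite qE in uq; apply: (uniq_cat_disj uq yA); rewrite inE yD orbT.
have bD := seg_last sD; have aA := seg_head sA.
have Ha' : a' = a \/ e a' a \/ e a' b.
  have [] := Ha a' a'q _; first by rewrite esym.
  - by left.
  - by move=> ab; case: (disj a'); rewrite ?(seg_last sA) // ab.
  - by right; left.
  - by right; right.
have Hb' : b' = b \/ e b' b \/ e b' a.
  have [] := Ha b' b'q eb'.
  - by move=> ba; case: (disj a); rewrite // -ba (seg_head sD).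
  - by left.
  - by right; right.
  - by right; left.
suff main : (a' = a \/ e a' a) -> (b' = b \/ e b' b) -> cyclic q.
  case: Ha' => [aa|[aa|/da//]]; case: Hb' => [bb|[bb|/db//]];
  by apply: main; by [left|right].
move=> {Ha' Hb'} aa bb; have [xA|nxA] := boolP (x2 \in A).
  by rewrite qE in uq Hb *; apply: insert_left sA ea' eb' sD _ _ aa bb xA _ _ _ Hb.
have xD : x2 \in rev D.
  by move: q2; rewrite qE mem_cat inE (negbTE nxA) eq_sym (negbTE x12) mem_rev.
(* When [x2] comes after [x1], the path is reversed and [a] and [b] exchange roles. *)
have pq : perm_eq (rev D ++ x1 :: rev A) q by rewrite qE; perm_by_count.
have uq' : uniq (rev D ++ x1 :: rev A) by rewrite (perm_uniq pq).
have Hb' : {in rev D ++ x1 :: rev A &, forall p p', e x2 p -> e x2 p' -> p != p' ->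
    p != x1 -> p' != x1 -> ~~ e x1 p -> ~~ e x1 p' -> e p p'}.
  by move=> p p'; rewrite !(perm_mem pq); apply: Hb.
have e1 : e b' x1 by rewrite esym.
have e2 : e x1 a' by rewrite esym.
have [c [x [y [s1 s2 s3]]]] := insert_left uq' (seg_rev esym sD) e1 e2 (seg_rev esym sA)
  e1b e1a bb aa xD x2b e2b e2a Hb'.
by apply: cyc s1 s2 _; apply: perm_trans s3 pq.
Qed.
End Insertion.

(** * Maximality under added pairs *)

Section Maximal.
Variable T : finType.
Implicit Types (e : rel T) (C w c : seq T) (B Y : {set T}) (x y a b : T).

Definition maximal_cycle e C w := forall c x y,
  seg e c x y -> e y x -> uniq c -> {subset C <= c} -> {subset c <= C ++ w} ->
  {subset c <= C}.

Lemma maximal_cycle_sub e e' C w :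
  subrel e e' -> maximal_cycle e' C w -> maximal_cycle e C w.
Proof.
by move=> sub mC c x y cs cyx; apply: mC (sub _ _ cyx); apply: seg_subrel cs.
Qed.

Lemma maximal_cycle_mem e C C' w w' : C =i C' -> w =i w' ->
  maximal_cycle e C w -> maximal_cycle e C' w'.
Proof.
move=> CC ww mC c x y cs cyx uc s1 s2 z zc; rewrite -CC.
apply: (mC c x y) => // u uc'; first by apply: s1; rewrite -CC.
by have := s2 u uc'; rewrite !mem_cat CC ww.
Qed.

(** A cycle through the new pair opens to a path from [a] to [b]; it contains [x1] and [x2] because
    the cycle contains [C], so [close_path] replaces it by a cycle of [e] on the same vertices. *)
Lemma maximal_cycle_addp e C w a b x1 x2 : symmetric e -> uniq C -> 2 < size C ->
    maximal_cycle e C w ->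
    x1 \in C -> x2 \in C -> x1 != a -> x1 != b -> x2 != a -> x2 != b -> x1 != x2 ->
    e x1 a -> e x1 b -> e x2 a -> e x2 b ->
    {in C ++ w, forall p, e x1 p -> [\/ p = a, p = b, e p a | e p b]} ->
    {in C ++ w &, forall p p', e x2 p -> e x2 p' -> p != p' -> p != x1 -> p' != x1 ->
      ~~ e x1 p -> ~~ e x1 p' -> e p p'} ->
  maximal_cycle (addp e a b) C w.
Proof.
move=> esym uC C2 mC C1 C2' n1a n1b n2a n2b n12 e1a e1b e2a e2b Ha Hb c x y cs cyx uc s1 s2.
have c2 : 2 < size c by apply: leq_trans C2 (uniq_leq_size uC s1).
case: (cycle_addp esym uc c2 cs cyx) => [[x' [y' [h1 h2]]]|[q qc sq]].
  exact: (mC c x' y').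
have uq : uniq q by rewrite (perm_uniq qc).
have q1 : x1 \in q by rewrite (perm_mem qc) s1.
have q2 : x2 \in q by rewrite (perm_mem qc) s1.
have Ha' : {in q, forall p, e x1 p -> [\/ p = a, p = b, e p a | e p b]}.
  by move=> p pq; apply: Ha; apply: s2; rewrite -(perm_mem qc).
have Hb' : {in q &, forall p p', e x2 p -> e x2 p' -> p != p' -> p != x1 -> p' != x1 ->
    ~~ e x1 p -> ~~ e x1 p' -> e p p'}.
  by move=> p p' pq pq'; apply: Hb; apply: s2; rewrite -(perm_mem qc).
have [c' [x' [y' [h1 h2 h3]]]] :=
    close_path esym uq sq q1 q2 n1a n1b n2a n2b n12 e1a e1b e2a e2b Ha' Hb'.
have cc := perm_trans h3 qc.
have uc' : uniq c' by rewrite (perm_uniq cc).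
move=> z; rewrite -(perm_mem cc); apply: (mC c' x' y') => // u.
  by move=> uC'; rewrite (perm_mem cc) s1.
by rewrite (perm_mem cc); apply: s2.
Qed.

Definition clique_on e B : rel T := fun x y => e x y || [&& x != y, x \in B & y \in B].

Lemma clique_on_sym e B : symmetric e -> symmetric (clique_on e B).
Proof.
by move=> esym x y; rewrite /clique_on esym eq_sym [(x \in B) && _]andbC.
Qed.

Lemma sub_clique_on e B : subrel e (clique_on e B).
Proof. by move=> x y h; rewrite /clique_on h. Qed.

(** The pairs between [Y] and [B] are added one at a time. The hypotheses survive each addition: the
    neighbours of [x1] remain in [B] and [Y], and [x2] gains none outside them. *)
Lemma maximal_cycle_join e C w B Y x1 x2 : symmetric e -> uniq C -> 2 < size C ->
    maximal_cycle e C w -> {subset B <= C} -> {subset Y <= C} ->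
    (forall y, y \in Y -> y \notin B) ->
    {in B &, forall a b, a != b -> e a b} -> {in Y &, forall a b, a != b -> e a b} ->
    x1 \in B -> x2 \in B -> x1 != x2 ->
    (forall y, y \in Y -> e x1 y && e x2 y) ->
    {in C ++ w, forall p, e x1 p -> (p \in B) || (p \in Y)} ->
    {in C ++ w &, forall p p', e x2 p -> e x2 p' -> p != p' ->
      p \notin B -> p' \notin B -> p \notin Y -> p' \notin Y -> e p p'} ->
  maximal_cycle (clique_on e (B :|: Y)) C w.
Proof.
move=> esym uC C2 mC BC YC BY cB cY xB1 xB2 x12 xY Ha Hb.
pose add (l : seq (T * T)) : rel T := foldr (fun p e => addp e p.1 p.2) e l.
have add_sym l : symmetric (add l) by elim: l => [|p l IH] //; apply: addp_sym.
have add_sub l : subrel e (add l) by elim: l => [|p l IH] // x y /IH h; rewrite /= /addp h.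
have add_in l x y : {subset l <= setX Y B} -> add l x y ->
  [\/ e x y, (x \in Y) && (y \in B) | (x \in B) && (y \in Y)].
  elim: l => [|[y' b'] l IH] sl; first by constructor.
  have := sl (y', b') (mem_head _ _); rewrite inE /= => /andP[yY bB].
  case/addp_or=> [|[-> ->]|[-> ->]]; last 2 first.
  - by constructor 2; rewrite yY bB.
  - by constructor 3; rewrite yY bB.
  by apply: IH => p pl; apply: sl; rewrite inE pl orbT.
have mem_add l x y : (x, y) \in l -> add l x y /\ add l y x.
  elim: l => // [[y' b'] l] IH; rewrite inE => /orP[/eqP[-> ->]|/IH[h1 h2]].
    by rewrite /= /addp !eqxx !orbT.
  by rewrite /= /addp h1 h2.
have madd l : {subset l <= setX Y B} -> maximal_cycle (add l) C w.
  elim: l => [|[y b] l IH] // sl.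
  have sl' : {subset l <= setX Y B} by move=> p pl; apply: sl; rewrite inE pl orbT.
  have := sl (y, b) (mem_head _ _); rewrite inE /= => /andP[yY bB].
  have [eyb|neyb] := boolP (add l y b).
    apply: maximal_cycle_sub (IH sl') => u v /addp_or[//|[-> ->]|[-> ->]] //.
    by rewrite add_sym.
  have /andP[e1y e2y] := xY y yY.
  have xb1 : x1 != b by apply: contraNneq neyb => <-; rewrite add_sym add_sub.
  have xb2 : x2 != b by apply: contraNneq neyb => <-; rewrite add_sym add_sub.
  have xy z : z \in B -> z != y by move=> zB; apply: contraTneq zB => ->; apply: BY.
  have e1b := cB _ _ xB1 bB xb1; have e2b := cB _ _ xB2 bB xb2.
  have inBY x p : x \in B -> (e x p -> (p \in B) || (p \in Y)) -> add l x p ->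
      (p \in B) || (p \in Y).
    move=> xB h /(add_in _ _ _ sl')[//|/andP[_ ->]//|/andP[_ ->]].
    exact: orbT.
  apply: (maximal_cycle_addp (add_sym l) uC C2 (IH sl') (BC _ xB1) (BC _ xB2)
    (xy _ xB1) xb1 (xy _ xB2) xb2 x12 (add_sub l _ _ e1y) (add_sub l _ _ e1b)
    (add_sub l _ _ e2y) (add_sub l _ _ e2b)).
    move=> p pC /(inBY _ _ xB1 (Ha p pC))/orP[pB|pY].
      have [->|pb] := eqVneq p b; first by constructor 2.
      by constructor 4; apply: add_sub; apply: cB.
    have [->|pb] := eqVneq p y; first by constructor 1.
    by constructor 3; apply: add_sub; apply: cY.
  move=> p p' pC pC' e2p e2p' pp p1 p1' n1 n1'.
  have out z : z != x1 -> ~~ add l x1 z -> z \notin B /\ z \notin Y.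
    move=> z1 nz; split; apply: contra nz => h; apply: add_sub.
      by apply: cB; rewrite // eq_sym.
    by case/andP: (xY z h).
  have [[nB nY] [nB' nY']] := (out _ p1 n1, out _ p1' n1').
  have old z : z \notin B -> z \notin Y -> add l x2 z -> e x2 z.
    move=> nzB nzY /(add_in _ _ _ sl')[//|/andP[_ zB]|/andP[_ zY]].
      by rewrite zB in nzB.
    by rewrite zY in nzY.
  by apply: add_sub; apply: Hb; rewrite ?old.
have mE : maximal_cycle (add (enum (setX Y B))) C w.
  by apply: madd => p; rewrite mem_enum.
apply: maximal_cycle_sub mE => x y /orP[|/and3P[xny]]; first exact: add_sub.
have memE u v : u \in Y -> v \in B -> (u, v) \in enum (setX Y B).
  by move=> uY vB; rewrite mem_enum inE /= uY vB.
rewrite !inE => /orP[xB|xY'] /orP[yB|yY].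
- by apply: add_sub; apply: cB.
- by case: (mem_add _ _ _ (memE _ _ yY xB)).
- by case: (mem_add _ _ _ (memE _ _ xY' yB)).
- by apply: add_sub; apply: cY.
Qed.

End Maximal.

(** * A cycle with an outer path *)

(* The cycle is [v :: T]; [e] consists of the edges of G and of further pairs which
   have been shown to create no longer cycle through part of the outer path [w]. *)
Record rooted_cycle (G : sgraph) (e : rel G) (v : G) (T w : seq G) : Prop := RootedCycle {
  rc_claw : f_heavy claw G;
  rc_wounded : f_heavy wounded G;
  rc_sym : symmetric e;
  rc_sub : subrel (@hadj G) e;
  rc_uniq : uniq (v :: T);
  rc_size : 1 < size T;
  rc_seg : seg (@adj G) T (head v T) (last v T);
  rc_head : adj v (head v T);
  rc_last : adj v (last v T);
  rc_heavy : forall x, heavy x -> x \in v :: T;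
  rc_out : forall z, z \in w -> z \notin v :: T;
  rc_max : maximal_cycle e (v :: T) w }.

(** Any path inside [w] is allowed, so that vertices attached to inner vertices of [w] are covered
    too. *)
Definition linked (G : sgraph) (w : seq G) (x y : G) :=
  exists w' z z', [/\ uniq w', {subset w' <= w}, seg (@adj G) w' z z', adj x z & adj z' y].

(** * Exchanges around a vertex linked to the root *)

Section Rooted.
Variables (G : sgraph) (e : rel G) (v : G) (T w : seq G).
Hypothesis rc : rooted_cycle e v T w.
Implicit Types (x y z s t : G) (X Y q : seq G).
Local Notation vp := (head v T).
Local Notation vm := (last v T).
Let esym := rc_sym rc.

Lemma rc_adj : subrel (@adj G) e.
Proof. by move=> x y /adj_hadj/(rc_sub rc). Qed.

Lemma rc_light z : z \in w -> ~~ heavy z.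
Proof. by move=> zw; apply: contra (rc_out rc zw); apply: (rc_heavy rc). Qed.

Lemma rc_vT : v \notin T.
Proof. by have /andP[] := rc_uniq rc. Qed.

Lemma rc_vp : vp \in T. Proof. exact: seg_head (rc_seg rc). Qed.
Lemma rc_vm : vm \in T. Proof. exact: seg_last (rc_seg rc). Qed.

Lemma rc_vpm : vp != vm.
Proof.
have := rc_size rc; have /andP[_] := rc_uniq rc; have := rc_seg rc.
case: (T) => [|a [|b t]] //= _ /andP[na _] _.
by apply: contraNneq na => ->; apply: mem_last.
Qed.

Lemma no_spanning_path X y Y q a b : linked w v y -> T = X ++ y :: Y ->
  perm_eq q (X ++ Y) -> seg e q a b -> e v a -> e b y -> False.
Proof.
move=> [w' [z [z' [uw' sw' sz vz zy]]]] TE pq sq va by_.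
have zw : z \in w by apply/sw'/(seg_head sz).
have sc : seg e (v :: q ++ y :: rev w') v z.
  apply: seg_cons va (seg_cat sq by_ (seg_cons _ _)).
    by apply: rc_adj; rewrite adj_sym; exact: zy.
  by apply: seg_rev => //; apply: seg_subrel rc_adj sz.
have memq u : (u \in q) = (u \in X ++ Y) by rewrite (perm_mem pq).
have := rc_max rc sc (rc_adj (etrans (adj_sym _ _) vz)).
have outw u : u \in w' -> u \notin v :: T by move=> /sw'; apply: (rc_out rc).
have pc : perm_eq (v :: q ++ y :: rev w') ((v :: T) ++ w').
  have pq' := permP pq; apply/permP => P; move: (pq' P).
  by rewrite TE ?(count_cat, count_rev) /= ?(count_cat, count_rev) /=
    ?(count_cat, count_rev) /=; clear; lia.
rewrite (perm_uniq pc) => /(_ _ _ _ z).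
have -> : uniq ((v :: T) ++ w').
  rewrite cat_uniq uw' (rc_uniq rc) andbT /=; apply/hasPn => u uw; exact: outw.
move=> /(_ isT) h; have /negP := rc_out rc zw; apply; apply: h.
- by move=> u uC; rewrite (perm_mem pc) mem_cat uC.
- by move=> u; rewrite (perm_mem pc) !mem_cat => /orP[->//|/sw' ->]; rewrite orbT.
- by rewrite (perm_mem pc) mem_cat (seg_head sz) orbT.
Qed.

Lemma no_insertion X x Y y z : z \in w -> v :: T = rcons X x ++ y :: Y ->
  adj x z -> adj z y -> False.
Proof.
move=> zw TE xz zy.
have sT : seg e (v :: T) v vm.
  by apply: (seg_cons (rc_adj (rc_head rc))); apply: seg_subrel rc_adj (rc_seg rc).
have n0 : rcons X x <> [::] by case: (X).
rewrite TE in sT; case: (seg_catE n0 _ sT) => // x' [y' [s1 _ s2]].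
have yy : y' = y by case/andP: s2 => /eqP->.
have xx : x' = x by move: s1; case: (X) => [|? ?] /and3P[_ _ /eqP<-] //=; rewrite last_rcons.
rewrite {}yy {}xx in s1 s2.
have sc : seg e (rcons X x ++ [:: z] ++ (y :: Y)) v vm.
  by apply: seg_cat s1 (rc_adj xz) (seg_cat (seg1 _ _) (rc_adj zy) s2).
have ev : e vm v by apply: rc_adj; rewrite adj_sym; apply: (rc_last rc).
have pc : perm_eq (rcons X x ++ [:: z] ++ y :: Y) (z :: v :: T).
  by rewrite TE; perm_by_count.
have := rc_max rc sc ev; rewrite (perm_uniq pc) /= -/(uniq (v :: T)).
move: (rc_out rc zw) (rc_uniq rc) => /= -> -> /(_ isT) h.
have /negP := rc_out rc zw; apply; apply: h.
- by move=> u uC; rewrite (perm_mem pc) inE uC orbT.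
- move=> u; rewrite (perm_mem pc) in_cons => /orP[/eqP->|uC];
  by rewrite -cat_cons mem_cat ?zw ?uC ?orbT.
- by rewrite (perm_mem pc) mem_head.
Qed.

(** If [y] were next to [v] on the cycle, the rest of the cycle would be a forbidden spanning
    path. *)
Lemma linked_split X y Y : linked w v y -> T = X ++ y :: Y ->
  exists xl yh, [/\ seg (@adj G) X vp xl, adj xl y, adj y yh & seg (@adj G) Y yh vm].
Proof.
move=> ly TE; have sT := rc_seg rc.
have X0 : X <> [::].
  move=> X0; have Y0 : Y <> [::] by move=> Y0; have := rc_size rc; rewrite TE X0 Y0.
  have sT' : seg (@adj G) ([:: y] ++ Y) vp vm by move: sT; rewrite {1}TE X0.
  case: (seg_catE _ Y0 sT') => // y' [yh [s1 yy s2]].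
  have yE : y' = y by case/and3P: s1 => _ _ /eqP<-.
  apply: (no_spanning_path ly TE (q := rev Y) (a := vm) (b := yh)).
  - by rewrite X0 perm_rev.
  - by apply: seg_rev => //; apply: seg_subrel rc_adj s2.
  - by apply: rc_adj; apply: (rc_last rc).
  - by apply: rc_adj; rewrite adj_sym -yE.
have sT' : seg (@adj G) (X ++ y :: Y) vp vm by rewrite -TE.
case: (seg_catE X0 _ sT') => // xl [y' [s1 xy s2]].
have yE : y' = y by case/andP: s2 => /eqP->.
rewrite {}yE in xy s2; case: Y TE s2 {sT'} => [|yh Y] TE s2.
  exfalso; apply: (no_spanning_path ly TE (q := X) (a := vp) (b := xl)).
  - by rewrite cats0.
  - exact: seg_subrel rc_adj s1.
  - by apply: rc_adj; apply: (rc_head rc).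
  - exact: rc_adj.
by have [_ yyh sY] := seg_consE s2; exists xl, yh.
Qed.

Lemma linked1 x y z : z \in w -> adj x z -> adj z y -> linked w x y.
Proof.
move=> zw xz zy; exists [:: z], z, z; split=> //; last exact: seg1.
by move=> u; rewrite inE => /eqP->.
Qed.

Lemma linked_ends y : linked w v y -> y != vp /\ y != vm.
Proof.
move=> ly; split; apply/eqP => yE.
  have TE : T = [::] ++ y :: behead T by rewrite yE; case: (T) (rc_size rc).
  by case: (linked_split ly TE) => ? [? []].
have [X TE] := seg_lastE (rc_seg rc).
by rewrite -yE -cats1 in TE; case: (linked_split ly TE) => ? [? []].
Qed.

(** In the claw at [v] with leaves [z], [vp], [vm], the vertex [z] is light, and an edge from it to
    [vp] or [vm] would link [v] to a cycle neighbour. So [v] can be bypassed. *)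
Lemma hadj_vpm y : linked w v y -> hadj vp vm.
Proof.
case=> w' [z [z' [_ sw' sz vz _]]]; have zw : z \in w by apply/sw'/(seg_head sz).
have nz x : x \in T -> z != x.
  by move=> xT; apply: contraTneq xT => <-; have := rc_out rc zw; rewrite inE => /norP[].
have := claw_hadj (rc_claw rc) vz (rc_head rc) (rc_last rc) (nz _ rc_vp) (nz _ rc_vm) rc_vpm.
case/or3P=> [|| //] /(hadj_light (rc_light zw)) zx.
- by have [/eqP] := linked_ends (linked1 zw vz zx).
- by have [_ /eqP] := linked_ends (linked1 zw vz zx).
Qed.

(** The claw at [y] gives a bypass there as well; with [hadj_vpm], [X ++ Y] becomes a cycle of
    [e]. *)
Lemma linked_cycle X y Y : linked w v y -> T = X ++ y :: Y ->
  exists xl yh, [/\ seg e X vp xl, seg e Y yh vm, adj xl y, adj y yh & e xl yh].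
Proof.
move=> ly TE; have [xl [yh [sX xy yY sY]]] := linked_split ly TE.
exists xl, yh; split=> //; try exact: seg_subrel rc_adj _.
case: ly => w' [z' [z [_ sw' sz _ zy]]]; have zw : z \in w by apply/sw'/(seg_last sz).
have [X' XE] := seg_lastE sX; have [Y' YE] := seg_headE sY.
have zT x : x \in T -> z != x.
  by move=> xT; apply: contraTneq xT => <-; have := rc_out rc zw; rewrite inE => /norP[].
have xT : xl \in T by rewrite TE mem_cat (seg_last sX).
have yT : yh \in T by rewrite TE mem_cat inE (seg_head sY) !orbT.
have xy' : xl != yh.
  apply: contraTneq (rc_uniq rc) => xE; apply/negP => /andP[_]; rewrite TE => u.
  by case: (uniq_cat_disj u (seg_last sX)); rewrite xE inE (seg_head sY) orbT.
have yz : adj y z by rewrite adj_sym.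
have yx : adj y xl by rewrite adj_sym.
apply: (rc_sub rc); have := claw_hadj (rc_claw rc) yz yx yY (zT _ xT) (zT _ yT) xy'.
case/or3P=> [|| //] /(hadj_light (rc_light zw)) zx; exfalso.
  apply: (@no_insertion (v :: X') xl Y y z) => //; last by rewrite adj_sym.
  by rewrite TE XE rcons_cons.
by apply: (@no_insertion (v :: X) y Y' yh z) => //; rewrite TE YE -cats1 -catA.
Qed.

Section Avoid.
Variables (y : G) (X Y : seq G).
Hypotheses (ly : linked w v y) (TE : T = X ++ y :: Y).

Let evp : e v vp := rc_adj (rc_head rc).
Let evm : e v vm := rc_adj (rc_last rc).
Let emp : e vm vp.
Proof. by rewrite esym; apply: (rc_sub rc); apply: hadj_vpm ly. Qed.
Let epm : e vp vm.
Proof. by rewrite esym. Qed.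

Lemma linked_vm : ~~ e y vm.
Proof.
apply/negP; rewrite esym => h; have [xl [yh [sX sY xy yY xyh]]] := linked_cycle ly TE.
by apply: (no_spanning_path ly TE _ (seg_cat sX xyh sY) evp h).
Qed.

Lemma linked_vp : ~~ e y vp.
Proof.
apply/negP; rewrite esym => h; have [xl [yh [sX sY xy yY xyh]]] := linked_cycle ly TE.
rewrite esym in xyh; apply: (no_spanning_path ly TE (q := rev Y ++ rev X) _ _ evm h).
  by perm_by_count.
by apply: seg_cat (seg_rev esym sY) xyh (seg_rev esym sX).
Qed.

Lemma linked_nbrs : exists xl yh, [/\ seg e X vp xl, seg e Y yh vm & e xl yh] /\
  [/\ adj xl y, adj y yh, ~~ e v xl & ~~ e v yh].
Proof.
have [xl [yh [sX sY xy yY xyh]]] := linked_cycle ly TE; exists xl, yh; split; split=> //.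
  apply/negP => h; apply: (no_spanning_path ly TE (q := rev X ++ rev Y) _ _ h (b := yh)).
  - by perm_by_count.
  - exact: seg_cat (seg_rev esym sX) epm (seg_rev esym sY).
  - by rewrite esym; apply: rc_adj.
apply/negP => h; apply: (no_spanning_path ly TE (q := Y ++ X) _ _ h (b := xl)).
- by perm_by_count.
- exact: seg_cat sY emp sX.
- exact: rc_adj.
Qed.

(** Suppose [y] is joined to [s]. If [v] is joined to a cycle neighbour of [s], a path from there
    goes round to [s]; if the cycle neighbours of [s] are joined, [s] is bypassed and appended after
    [vm]. The last hypothesis is what a claw at [s] with leaf [v] provides. *)
Lemma linked_avoid s : s \in T -> s != y -> e v s -> s = vm \/ e s vm ->
    {in v :: T &, forall s0 s1, s0 != s1 -> adj s s0 -> adj s s1 -> s0 != v -> s1 != v ->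
      [\/ e v s0, e v s1 | e s0 s1]} ->
  ~~ e y s.
Proof.
move=> sT sy evs; have [-> _ _|nsm esm Ps] := eqVneq s vm; first exact: linked_vm.
have {}esm : e s vm by case: esm => // /eqP; rewrite (negbTE nsm).
have [->|nsp] := eqVneq s vp; first exact: linked_vp.
have [xl [yh [[sX sY xyh] [xy yY nvx nvy]]]] := linked_nbrs.
have [xl' [yh' [sX' _ _ sY']]] := linked_split ly TE.
have xE : xl' = xl by move: sX sX'; case: (X) => // a p /and3P[_ _ /eqP<-] /and3P[_ _ /eqP<-].
have yE : yh' = yh by move: sY sY'; case: (Y) => // a p /and3P[/eqP<- _ _] /and3P[/eqP<- _ _].
rewrite {}xE {}yE in sX' sY'.
have nsx : s != xl by apply: contraTneq evs => ->.
have nsy : s != yh by apply: contraTneq evs => ->.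
have yx : e yh xl by rewrite esym.
apply/negP; rewrite esym => esy.
have sT' := rc_uniq rc; rewrite /= TE in sT'; case/andP: sT' => vT uT.
have: s \in X \/ s \in Y.
  by move: sT; rewrite TE mem_cat inE (negbTE sy); case/orP; [left|right].
have neq_v z : z \in T -> z != v by apply: contraTneq => ->; exact: rc_vT.
have [sXY|] := boolP (s \in X) => [_|nsX [//|sYY]].
- have [X1 [X2 [s0 [s1 [XE s1g a0 a1 s2g]]]]] := split_mem_seg sX' sXY nsp nsx.
  have m0 : s0 \in T by rewrite TE XE !mem_cat (seg_last s1g).
  have m1 : s1 \in T by rewrite TE XE !mem_cat inE (seg_head s2g) !orbT.
  have n01 : s0 != s1.
    apply: contraTneq uT => E; apply/negP; rewrite XE -catA => u.
    by case: (uniq_cat_disj u (seg_last s1g)); rewrite E mem_cat inE (seg_head s2g) orbT.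
  have e1 := seg_subrel rc_adj s1g; have e2 := seg_subrel rc_adj s2g.
  have [h|h|h] := Ps s0 s1 (mem_behead (s := v :: T) m0) (mem_behead (s := v :: T) m1) n01
    (etrans (adj_sym _ _) a0) a1 (neq_v _ m0) (neq_v _ m1).
  + apply: (no_spanning_path ly TE (q := rev X1 ++ rev Y ++ rev X2 ++ [:: s]) _ _ h esy).
      by rewrite XE; perm_by_count.
    apply: seg_cat (seg_rev esym e1) epm (seg_cat (seg_rev esym sY) yx _).
    by apply: seg_cat (seg_rev esym e2) _ (seg1 _ _); rewrite esym; apply: rc_adj.
  + apply: (no_spanning_path ly TE (q := X2 ++ Y ++ X1 ++ [:: s]) _ _ h esy).
      by rewrite XE; perm_by_count.
    exact: seg_cat e2 xyh (seg_cat sY emp (seg_cat e1 (rc_adj a0) (seg1 _ _))).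
  + apply: (no_spanning_path ly TE (q := X1 ++ X2 ++ Y ++ [:: s]) _ _ evp esy).
      by rewrite XE; perm_by_count.
    by apply: seg_cat e1 h (seg_cat e2 xyh (seg_cat sY _ (seg1 _ _))); rewrite esym.
- have [Y1 [Y2 [s0 [s1 [YE s1g a0 a1 s2g]]]]] := split_mem_seg sY' sYY nsy nsm.
  have m0 : s0 \in T by rewrite TE YE !(mem_cat, inE) (seg_last s1g) !orbT.
  have m1 : s1 \in T by rewrite TE YE !(mem_cat, inE) (seg_head s2g) !orbT.
  have n01 : s0 != s1.
    apply: contraTneq uT => E; apply/negP; rewrite YE -cat_rcons catA => u.
    case: (uniq_cat_disj u (x := s0)); first by rewrite mem_cat (seg_last s1g) orbT.
    by rewrite E inE (seg_head s2g) orbT.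
  have e1 := seg_subrel rc_adj s1g; have e2 := seg_subrel rc_adj s2g.
  have [h|h|h] := Ps s0 s1 (mem_behead (s := v :: T) m0) (mem_behead (s := v :: T) m1) n01
    (etrans (adj_sym _ _) a0) a1 (neq_v _ m0) (neq_v _ m1).
  + apply: (no_spanning_path ly TE (q := rev Y1 ++ rev X ++ rev Y2 ++ [:: s]) _ _ h esy).
      by rewrite YE; perm_by_count.
    apply: seg_cat (seg_rev esym e1) yx (seg_cat (seg_rev esym sX) epm _).
    by apply: seg_cat (seg_rev esym e2) _ (seg1 _ _); rewrite esym; apply: rc_adj.
  + apply: (no_spanning_path ly TE (q := Y2 ++ X ++ Y1 ++ [:: s]) _ _ h esy).
      by rewrite YE; perm_by_count.
    exact: seg_cat e2 emp (seg_cat sX xyh (seg_cat e1 (rc_adj a0) (seg1 _ _))).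
  + apply: (no_spanning_path ly TE (q := X ++ Y1 ++ Y2 ++ [:: s]) _ _ evp esy).
      by rewrite YE; perm_by_count.
    by apply: seg_cat sX xyh (seg_cat e1 h (seg_cat e2 _ (seg1 _ _))); rewrite esym.
Qed.

End Avoid.

End Rooted.

Section Rooted.
Variables (G : sgraph) (e : rel G) (v : G) (T w : seq G).
Hypothesis rc : rooted_cycle e v T w.
Implicit Types (x y z s t : G) (X Y q : seq G).
Local Notation vp := (head v T).
Local Notation vm := (last v T).
Let esym := rc_sym rc.
Let radj := rc_adj rc.

(* The wounded graph on the triangle v, y, z, the edge from y to its successor
   and the first two vertices around the exit of N(v) along the cycle. *)
Lemma no_triangle y z : z \in w -> adj v z -> adj z y -> y \in T -> ~~ adj v y.
Proof.
move=> zw vz zy yT; apply/negP => vy.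
have ly := linked1 zw vz zy; have [X [Y TE]] := mem_split yT.
have [xl [yh [[sX sY xyh] [xy yY nvx nvy]]]] := linked_nbrs rc ly TE.
have [xl' [_ [sX' _ _ _]]] := linked_split rc ly TE.
have [_ xE] := seg_eq sX' sX; rewrite {}xE in sX'.
have navx : ~~ adj v xl by apply: contra nvx; apply: radj.
have navy : ~~ adj v yh by apply: contra nvy; apply: radj.
have epm : e vp vm by apply/(rc_sub rc)/(hadj_vpm rc ly).
have evm : e v vm := radj (rc_last rc).
have yx : e yh xl by rewrite esym.
pose reach X1 := X1 = [::] \/ exists2 x0, seg e X1 vp x0 & e v x0.
(* Since the predecessor of [x] is joined to [v], or is [v] itself, each of these adjacencies would
   give a forbidden spanning path. This will apply to both [b] and [q0]. *)
have R X1 x X2 : X = X1 ++ x :: X2 -> reach X1 -> [/\ ~~ adj x z, ~~ e x y & ~~ e x yh].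
  move=> XE [X10|[x0 s1 vx0]].
    have xvp : x = vp by move: sX; rewrite XE X10 => /and3P[/eqP].
    split; apply/negP => h; last 2 first.
    - by have /negP := linked_vp rc ly TE; rewrite esym -xvp.
    - apply: (no_spanning_path rc ly TE (q := rev Y ++ X) _ _ evm (radj xy)).
        by perm_by_count.
      by apply: seg_cat (seg_rev esym sY) _ sX; rewrite esym -xvp.
    have := linked_ends rc (linked1 zw vz (etrans (adj_sym _ _) h)).
    by rewrite xvp => -[/eqP].
  have X1n := seg_n0 s1.
  have sxX : seg e (X1 ++ x :: X2) vp xl by rewrite -XE.
  case: (seg_catE X1n _ sxX) => // x0' [x' [s1' x0x s2]].
  have [_ E0] := seg_eq s1' s1; rewrite {}E0 {s1'} in x0x.
  have xx : x' = x by case/andP: s2 => /eqP->.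
  rewrite {}xx in x0x s2.
  split; apply/negP => h.
  - have lx := linked1 zw vz (etrans (adj_sym _ _) h).
    have TE' : T = X1 ++ x :: (X2 ++ y :: Y) by rewrite TE XE -catA.
    have [x0'' [? [[s1'' _ _] [_ _ /negP n _]]]] := linked_nbrs rc lx TE'.
    by have [_ E] := seg_eq s1'' s1; rewrite E in n.
  - apply: (no_spanning_path rc ly TE (q := rev X1 ++ rev Y ++ rev (x :: X2)) _ _ vx0 (b := x)).
    + by rewrite XE; perm_by_count.
    + apply: seg_cat (seg_rev esym s1) epm (seg_cat (seg_rev esym sY) yx _).
      exact: seg_rev.
    + exact: h.
  - apply: (no_spanning_path rc ly TE (q := rev X1 ++ rev Y ++ x :: X2) _ _ vx0 (radj xy)).
      by rewrite XE; perm_by_count.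
    by apply: seg_cat (seg_rev esym s1) epm (seg_cat (seg_rev esym sY) _ s2); rewrite esym.
(* [q0] is the first vertex of [X] that is not adjacent to [v]; its predecessor [b] is still
   adjacent to [v]. *)
have [Xp [q0 [Xr [XE vXp nvq]]]] := split_prefix (seg_last sX) navx.
have Xp0 : Xp <> [::].
  move=> Xp0; move: sX' nvq; rewrite XE Xp0 => /and3P[/eqP-> _ _].
  by rewrite (rc_head rc).
have sXX : seg (@adj G) (Xp ++ q0 :: Xr) vp xl by rewrite -XE.
case: (seg_catE Xp0 _ sXX) => // b [q0' [sXp bq sXr]].
have qE : q0' = q0 by case/andP: sXr => /eqP->.
rewrite {}qE in bq.
have vb : adj v b by apply: (allP vXp); apply: seg_last sXp.
have sXp' := seg_subrel radj sXp.
have [nqz nyq nqh] := R Xp q0 Xr XE (or_intror (ex_intro2 _ _ b sXp' (radj vb))).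
have [nbz nyb nbh] : [/\ ~~ adj b z, ~~ e b y & ~~ e b yh].
  have [X1 X1E] := seg_lastE sXp.
  apply: (R X1 b (q0 :: Xr)); first by rewrite XE X1E cat_rcons.
  have [X10|X1n] := altP (X1 =P [::]); first by left.
  right; move: sXp' vXp; rewrite X1E -cats1 all_cat => s1 /andP[vX1 _].
  case: (seg_catE _ _ s1) => [/eqP|//|x0 [? [s0 _ _]]]; first by rewrite (negbTE X1n).
  by exists x0 => //; apply/radj/(allP vX1)/(seg_last s0).
have nbyh : b != yh.
  have := rc_uniq rc; rewrite /= TE => /andP[_ u]; apply/eqP => E.
  apply: (uniq_cat_disj u (x := b)); first by rewrite XE mem_cat (seg_last sXp).
  by rewrite E inE (seg_head sY) orbT.
have [Y' YE] := seg_headE sY.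
have nzh : ~~ adj z yh.
  apply/negP => h; apply: (no_insertion rc (X := v :: X) (x := y) (Y := Y') zw _ _ h).
    by rewrite TE YE -cats1 -catA.
  by rewrite adj_sym.
have nadj a b' : ~~ e a b' -> ~~ adj a b' by apply: contra; apply: radj.
have nadj' a b' : ~~ e a b' -> ~~ adj b' a by rewrite adj_sym; apply: nadj.
have nzb : ~~ adj z b by rewrite adj_sym.
have nzq : ~~ adj z q0 by rewrite adj_sym.
have yz : adj y z by rewrite adj_sym.
have [] := wounded_heavy (rc_wounded rc) vy yz vz vb bq yY navy nvq (nadj' _ _ nyb)
  (nadj' _ _ nyq) nzb nzh nzq (nadj _ _ nbh) (nadj' _ _ nqh).
(* The light vertex [z] stands between [yh] and [b] in the chain, so both are heavy, hence joined,
   against [nbh]. *)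
rewrite (negbTE (rc_light rc zw)) orbF => _ _ hyh /= hb _.
by have /negP := nbh; apply; apply: (rc_sub rc); apply: heavy_hadj.
Qed.

(** Passes from detours with one vertex to arbitrary ones: in the claw at [v] with leaves [z], [y],
    [vp], each of the three possible pairs is excluded. *)
Lemma linked_nadj y : linked w v y -> y \in T -> ~~ adj v y.
Proof.
move=> ly yT; apply/negP => vy; have [X [Y TE]] := mem_split yT.
case: (ly) => w' [z [z' [_ sw' sz vz _]]]; have zw : z \in w by apply/sw'/(seg_head sz).
have nz x : x \in T -> z != x.
  by move=> xT; apply: contraTneq xT => <-; have := rc_out rc zw; rewrite inE => /norP[].
have [nyp _] := linked_ends rc ly.
have := claw_hadj (rc_claw rc) vz vy (rc_head rc) (nz _ yT) (nz _ (rc_vp rc)) nyp.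
case/or3P=> [/(hadj_light (rc_light rc zw)) zy|/(hadj_light (rc_light rc zw)) zx|yvp].
- by have /negP := no_triangle zw vz zy yT.
- by have [/eqP] := linked_ends rc (linked1 zw vz zx).
- by have /negP := linked_vp rc ly TE; apply; apply: (rc_sub rc).
Qed.

End Rooted.

(** * Chords from the neighbours of the root *)

Section Cycles.
Variables (T : eqType) (e : rel T).
Hypothesis esym : symmetric e.
Implicit Types (c s : seq T) (x y : T).

Lemma seg_cycle s x y : seg e s x y -> e y x -> cycle e s.
Proof. by case: s => //= a s /and3P[/eqP-> es /eqP<-]; rewrite rcons_path es. Qed.

Lemma cycle_seg x s : cycle e (x :: s) -> seg e (x :: s) x (last x s) /\ e (last x s) x.
Proof. by rewrite /= rcons_path !eqxx => /andP[-> ->]. Qed.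

Lemma next_cat s x y s' : uniq (s ++ x :: y :: s') -> next (s ++ x :: y :: s') x = y.
Proof. by move=> u; rewrite -(next_rot (size s)) // rot_size_cat /= eqxx. Qed.

Lemma next_last x s : uniq (x :: s) -> next (x :: s) (last x s) = x.
Proof.
case/lastP: s => [|s y]; first by rewrite /= eqxx.
rewrite last_rcons -rcons_cons -cats1 => u.
by rewrite -(next_rot (size (x :: s))) // rot_size_cat /= eqxx.
Qed.

(* The exchanges of edges of the cycle [t :: Z1 ++ y :: Z2] with a chord [t y]
   which turn it into a spanning path from P to Q. *)
Lemma crossing_path (P Q : pred T) t y Z1 Z2 t0 t1 y0 y1 :
    e t t1 -> seg e Z1 t1 y0 -> e y0 y -> e y y1 -> seg e Z2 y1 t0 -> e t0 t ->
    P t -> Q y -> e t y -> P t0 && P t1 || e t0 t1 ->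
    [|| Q y0, Q y1, e t y0, e t y1 | e y0 y1] ->
    [\/ P t0, P t1 | exists m p U V, [/\ e m t, P p &
       [/\ Z1 = U ++ V, seg e U t1 m & seg e V p y0] \/
       [/\ Z2 = U ++ V, seg e U y1 m & seg e V p t0]]] ->
  exists q a b, [/\ perm_eq q (t :: Z1 ++ y :: Z2), seg e q a b, P a & Q b].
Proof.
move=> tt1 s1 y0y yy1 s2 t0t Pt Qy ty HT HY HC.
have [t1t yy0 y1y tt0 yt] : [/\ e t1 t, e y y0, e y1 y, e t t0 & e y t].
  by split; rewrite esym.
have r1 := seg_rev esym s1; have r2 := seg_rev esym s2.
have res q a b : seg e q a b -> perm_eq q (t :: Z1 ++ y :: Z2) -> P a -> Q b ->
    exists q a b, [/\ perm_eq q (t :: Z1 ++ y :: Z2), seg e q a b, P a & Q b].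
  by move=> *; exists q, a, b.
case/orP: HT => [/andP[Pt0 Pt1]|t01].
- case/or4P: HY => [Qy0|Qy1|ty0|/orP[ty1|y01]].
  + apply: res (seg_cat (seg_rev esym (seg_cons yy1 s2)) yt (seg_cons tt1 s1)) _ Pt0 Qy0.
    by perm_by_count.
  + apply: res (seg_cat s1 y0y (seg_cons yt (seg_cons tt0 r2))) _ Pt1 Qy1.
    by perm_by_count.
  + rewrite esym in ty0.
    apply: res (seg_cat s1 ty0 (seg_cons tt0 (seg_cat r2 y1y (seg1 _ _)))) _ Pt1 Qy.
    by perm_by_count.
  + rewrite esym in ty1.
    apply: res (seg_cat r2 ty1 (seg_cons tt1 (seg_cat s1 y0y (seg1 _ _)))) _ Pt0 Qy.
    by perm_by_count.
  + apply: res (seg_cat s1 y01 (seg_cat s2 t0t (seg_cons ty (seg1 _ _)))) _ Pt1 Qy.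
    by perm_by_count.
have t10 : e t1 t0 by rewrite esym.
case/or4P: HY => [Qy0|Qy1|ty0|/orP[ty1|y01]].
- apply: res (seg_cons ty (seg_cons yy1 (seg_cat s2 t01 s1))) _ Pt Qy0.
  by perm_by_count.
- apply: res (seg_cons ty (seg_cons yy0 (seg_cat r1 t10 r2))) _ Pt Qy1.
  by perm_by_count.
- apply: res (seg_cons ty0 (seg_cat r1 t10 (seg_cat r2 y1y (seg1 _ _)))) _ Pt Qy.
  by perm_by_count.
- apply: res (seg_cons ty1 (seg_cat s2 t01 (seg_cat s1 y0y (seg1 _ _)))) _ Pt Qy.
  by perm_by_count.
have y10 : e y1 y0 by rewrite esym.
(* Now both [t] and [y] can be bypassed. The remaining cycle is opened between a vertex of [P] and a
   vertex joined to [t], and [t], [y] are appended at the latter. *)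
case: HC => [Pt0|Pt1|[m [p [U [V [mt Pp HUV]]]]]].
- apply: res (seg_cat r2 y10 (seg_cat r1 t1t (seg_cons ty (seg1 _ _)))) _ Pt0 Qy.
  by perm_by_count.
- apply: res (seg_cat s1 y01 (seg_cat s2 t0t (seg_cons ty (seg1 _ _)))) _ Pt1 Qy.
  by perm_by_count.
case: HUV => -[ZE sU sV].
  apply: res (seg_cat sV y01 (seg_cat s2 t01 (seg_cat sU mt (seg_cons ty (seg1 _ _))))) _ Pp Qy.
  by rewrite ZE; perm_by_count.
apply: res (seg_cat sV t01 (seg_cat s1 y01 (seg_cat sU mt (seg_cons ty (seg1 _ _))))) _ Pp Qy.
by rewrite ZE; perm_by_count.
Qed.

End Cycles.

Section Chord.
Variables (G : sgraph) (e : rel G) (v : G) (T w : seq G).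
Hypothesis rc : rooted_cycle e v T w.
Implicit Types (x y s t : G) (q : seq G).
Local Notation vp := (head v T).
Local Notation vm := (last v T).
Let esym := rc_sym rc.
Let radj := rc_adj rc.

Lemma rc_vNT x : x \in T -> x != v.
Proof. by apply: contraTneq => ->; apply: rc_vT rc. Qed.

Lemma rc_wNT z x : z \in w -> x \in T -> z != x.
Proof.
by move=> zw; apply: contraTneq => <-; have := rc_out rc zw; rewrite inE => /norP[].
Qed.

(** The light leaf [z] of the claw at [v] is adjacent to neither [s] nor [t], as linked vertices are
    not adjacent to [v]. *)
Lemma star_clique z s t : z \in w -> adj v z -> s \in T -> t \in T ->
  adj v s -> adj v t -> s != t -> hadj s t.
Proof.
move=> zw vz sT tT vs vt st.
have := claw_hadj (rc_claw rc) vz vs vt (rc_wNT zw sT) (rc_wNT zw tT) st.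
case/or3P=> // /(hadj_light (rc_light rc zw)) zx.
  by have /negP := linked_nadj rc (linked1 zw vz zx) sT.
by have /negP := linked_nadj rc (linked1 zw vz zx) tT.
Qed.

Lemma star_avoid y t : linked w v y -> y \in T -> t \in T -> adj v t -> ~~ e y t.
Proof.
move=> ly yT tT vt; have [X [Y TE]] := mem_split yT.
apply: (linked_avoid rc ly TE tT).
- by apply: contraTneq vt => ->; apply: (linked_nadj rc).
- exact: radj.
- have [->|tm] := eqVneq t vm; [by left|right].
  case: ly => w' [z [z' [_ sw' sz vz _]]]; have zw : z \in w by apply/sw'/(seg_head sz).
  by apply/(rc_sub rc)/(star_clique zw vz tT (rc_vm rc) vt (rc_last rc) tm).
move=> s0 s1 _ _ s01 ts0 ts1 s0v s1v; rewrite adj_sym in vt.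
have := claw_hadj (rc_claw rc) vt ts0 ts1.
rewrite ![v == _]eq_sym s0v s1v => /(_ isT isT s01)/or3P[] /(rc_sub rc) h;
  by [constructor 1|constructor 2|constructor 3].
Qed.

(* [next c a] is heavy and follows a vertex joined to [v] on the cycle [c], which is
   [v :: T] with [v] and [u] bypassed. *)
Definition heavy_exit (u : G) (c : seq G) := exists a,
  [/\ a \in c, e v a, e v (next c a), heavy (next c a) & ~~ e u (next c a)].

Variables (u : G) (X Y : seq G).
Hypotheses (lu : linked w v u) (TE : T = X ++ u :: Y).
Local Notation c0 := (X ++ Y).

Lemma c0_uniq : uniq c0.
Proof.
have := rc_uniq rc; rewrite /= TE => /andP[_].
by rewrite (uniq_catCA X [:: u] Y) => /andP[].
Qed.

Lemma c0_mem x : (x \in c0) = (x \in T) && (x != u).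
Proof.
have := rc_uniq rc; rewrite /= TE => /andP[_].
rewrite (uniq_catCA X [:: u] Y) => /andP[nu _].
rewrite !mem_cat inE; have [->|xu] := eqVneq x u; last by rewrite andbT.
by rewrite orbT andbF -mem_cat (negbTE nu).
Qed.

(** Only the two bypass pairs may fail to be edges of G; claws and wounded graphs need the true
    edges. *)
Lemma c0_next xl yh x : seg e X vp xl -> seg e Y yh vm -> x \in c0 ->
  [\/ adj x (next c0 x), x = vm /\ next c0 x = vp | x = xl /\ next c0 x = yh].
Proof.
move=> sX sY; have [xl' [yh' [sX' _ _ sY']]] := linked_split rc lu TE.
have [_ xE] := seg_eq sX' sX; have [yE _] := seg_eq sY' sY; rewrite {}xE {}yE in sX' sY'.
have u0 := c0_uniq.
rewrite mem_cat => /orP[] /splitPr xq; case: xq sX sX' sY sY' u0.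
- move=> X1 [|x1 X2] sX sX' sY sY' u0.
    constructor 3; have [Y' YE] := seg_headE sY; rewrite YE in u0 *.
    rewrite -catA /= in u0 *; rewrite next_cat //; split=> //.
    by have [s' /eqP] := seg_lastE sX; rewrite cats1 eqseq_rcons => /andP[_ /eqP].
  constructor 1; rewrite -catA /= in u0 *; rewrite next_cat //.
  case: X1 sX' {sX u0} => [|a X1] sX'; first by have [_] := seg_consE sX'.
  case: (seg_catE _ _ sX') => // ? [? [_ _ s2]].
  by have [_] := seg_consE s2.
move=> Y1 [|x1 Y2] sX sX' sY sY' u0.
  constructor 2; have [X' XE] := seg_headE sX.
  have xE : x = vm.
    by have [s' /eqP] := seg_lastE sY; rewrite cats1 eqseq_rcons => /andP[_ /eqP].
  split=> //; rewrite XE /= in u0 *.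
  have := next_last u0; rewrite !last_cat /=.
  by [].
constructor 1; rewrite catA in u0 *; rewrite next_cat //.
case: Y1 sY' {sY u0} => [|a Y1] sY'; first by have [_] := seg_consE sY'.
case: (seg_catE _ _ sY') => // ? [? [_ _ s2]].
by have [_] := seg_consE s2.
Qed.

Lemma c0_rot xl yh x : seg e X vp xl -> seg e Y yh vm -> e xl yh -> x \in c0 ->
  exists Z x1 x0, [/\ seg e Z x1 x0, e x x1, e x0 x, perm_eq (x :: Z) c0 &
   next c0 =1 next (x :: Z)].
Proof.
move=> sX sY xy xc; have u0 := c0_uniq.
have cyc : cycle e c0.
  apply: seg_cycle (seg_cat sX xy sY) _; rewrite esym; apply/(rc_sub rc)/(hadj_vpm rc lu).
have [i Z rE] := rot_to xc.
have uZ : uniq (x :: Z) by rewrite -rE rot_uniq.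
rewrite -(rot_cycle i) rE in cyc; have [s1 h] := cycle_seg cyc.
case: Z rE uZ cyc s1 h => [|x1 Z] rE uZ cyc s1 h.
  have : size c0 = 1 by rewrite -(size_rot i) rE.
  move: (seg_n0 sX) (seg_n0 sY); rewrite size_cat; clear; case: X => // ? ?; case: Y => // ? ? _ _ /=.
  by rewrite addnS.
have [_ xx1 sZ] := seg_consE s1.
exists (x1 :: Z), x1, (last x (x1 :: Z)); split=> //.
  by rewrite -rE perm_rot.
by move=> y; rewrite -rE next_rot.
Qed.

End Chord.

Section Chord.
Variables (G : sgraph) (e : rel G) (v : G) (T w : seq G).
Hypothesis rc : rooted_cycle e v T w.
Implicit Types (x y s t : G).
Local Notation vp := (head v T).
Local Notation vm := (last v T).
Let esym := rc_sym rc.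
Let radj := rc_adj rc.
Variables (u : G) (X Y : seq G).
Hypotheses (lu : linked w v u) (TE : T = X ++ u :: Y).
Local Notation c0 := (X ++ Y).

Variables z c1 : G.
Hypotheses (zw : z \in w) (vz : adj v z) (zc : adj z c1) (nvc : ~~ adj v c1).
Hypothesis hc1 : c1 = u \/ forall x, x \in T -> adj x c1 -> linked w v x.
Hypothesis hvu : heavy v -> heavy u.

Lemma u_in : u \in T. Proof. by rewrite TE mem_cat inE eqxx orbT. Qed.

(** Unless [t] and [s] form a mere heavy pair, there is a wounded graph with triangle [v], [t], [s],
    long arm [z], [c1] at [v] and pendant [q] at [t]; its light vertex [z] forces [t] and [s] to be
    heavy. *)
Lemma exit_heavy t s q : t \in T -> s \in T -> q \in T -> adj v t -> adj v s ->
  t != s -> adj t q -> ~~ e v q -> ~~ e u q -> ~~ e s q -> heavy t && heavy s.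
Proof.
move=> tT sT qT vt vs ts tq nvq nuq nsq.
have := star_clique rc zw vz tT sT vt vs ts; case/orP=> [ats|/and3P[_ -> ->//]].
have nz x : x \in T -> adj v x -> ~~ adj x z.
  move=> xT vx; apply/negP => h; rewrite adj_sym in h.
  by have /negP := linked_nadj rc (linked1 zw vz h) xT.
have nc x : x \in T -> adj v x -> ~~ adj x c1.
  move=> xT vx; case: hc1 => [->|hl].
    by apply: contra (star_avoid rc lu u_in xT vx); rewrite adj_sym; apply: radj.
  by apply/negP => /(hl _ xT) lx; have /negP := linked_nadj rc lx xT.
have nadj a b : ~~ e a b -> ~~ adj a b by apply: contra; apply: radj.
have nzq : ~~ adj z q.
  apply/negP => h; have := star_avoid rc (linked1 zw vz h) qT tT vt.
  by rewrite esym radj.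
have nqc : ~~ adj q c1.
  case: hc1 => [->|hl]; first by rewrite adj_sym nadj.
  apply/negP => /(hl _ qT) lq; have := star_avoid rc lq qT tT vt.
  by rewrite esym radj.
have [] := wounded_heavy (rc_wounded rc) vt ats vs vz zc tq (nadj _ _ nvq) nvc
  (nz _ tT vt) (nc _ tT vt) (nz _ sT vs) (nadj _ _ nsq) (nc _ sT vs) nzq nqc.
by rewrite (negbTE (rc_light rc zw)) orbF => _ _ _ -> /= ->.
Qed.

(* Unless two consecutive neighbours of v are heavy, either t can be bypassed or
   both its neighbours on the cycle are joined to v. *)
Lemma star_bypass t t0 t1 Z : t \in T -> adj v t -> seg e Z t1 t0 -> e t t1 -> e t0 t ->
    perm_eq (t :: Z) c0 -> (adj t t1 \/ t = vm /\ t1 = vp) -> (adj t t0 \/ t = vp /\ t0 = vm) ->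
    next c0 t = t1 -> next c0 t0 = t ->
  heavy_exit e v u c0 \/ (e v t0 && e v t1 || e t0 t1).
Proof.
move=> tT vt sZ tt1 t0t pZ a1 a0 n1 n0.
have evt := radj vt.
have mem x : (x \in t :: Z) = (x \in T) && (x != u) by rewrite (perm_mem pZ) (c0_mem rc TE).
have t0Z := seg_last sZ; have t1Z := seg_head sZ.
have /andP[t0T t0u] : (t0 \in T) && (t0 != u) by rewrite -mem inE t0Z orbT.
have /andP[t1T t1u] : (t1 \in T) && (t1 != u) by rewrite -mem inE t1Z orbT.
have /andP[ntZ uZ] : uniq (t :: Z) by rewrite (perm_uniq pZ); apply: (c0_uniq rc TE).
have tt0' : t != t0 by apply: contraNneq ntZ => ->.
have tt1' : t != t1 by apply: contraNneq ntZ => ->.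
have no q b : perm_eq q (t :: Z) -> seg e q t b -> ~~ e u b.
  move=> pq sq; apply/negP; rewrite esym => h.
  exact: (no_spanning_path rc lu TE (perm_trans pq pZ) sq evt h).
have nu0 : ~~ e u t0 by apply: (no (t :: Z) _ _ (seg_cons tt1 sZ)).
have nu1 : ~~ e u t1.
  apply: (no (t :: rev Z)); first by rewrite perm_cons perm_rev.
  by apply: seg_cons (seg_rev esym sZ); rewrite esym.
have nut : ~~ e u t by apply: (star_avoid rc lu u_in tT vt).
(* A heavy pair at [v] would make [u] heavy by [hvu], and then [u] would be joined to the heavy
   vertex [x]. *)
have real x : ~~ e u x -> x != u -> hadj v x -> adj v x.
  move=> nux xu /orP[//|/and3P[_ /hvu hu hx]]; case/negP: nux.
  by apply/(rc_sub rc)/heavy_hadj; rewrite 1?eq_sym.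
have [h01|n01] := boolP (e t0 t1); first by right; rewrite orbT.
have H : adj v t0 \/ adj v t1.
  case: a0 => [a0|[_ ->]]; last by left; apply: (rc_last rc).
  case: a1 => [a1|[_ ->]]; last by right; apply: (rc_head rc).
  (* If [t0] and [t1] coincide, the bypassed cycle has only two vertices, namely [vp] and [vm]. *)
  have [E|t01] := eqVneq t0 t1.
    rewrite -E in sZ; have ZE := seg_size1 uZ sZ; left.
    have [up um] := linked_ends rc lu.
    have: vp \in t :: Z by rewrite mem (rc_vp rc) eq_sym.
    have: vm \in t :: Z by rewrite mem (rc_vm rc) eq_sym.
    rewrite ZE !inE => /orP[/eqP mt|/eqP <- _]; last exact: (rc_last rc).
    case/orP=> [/eqP pt|/eqP <-]; last exact: (rc_head rc).
    by have := rc_vpm rc; rewrite mt pt eqxx.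
  rewrite adj_sym in vt; have := claw_hadj (rc_claw rc) vt a0 a1.
  rewrite ![v == _]eq_sym !(rc_vNT rc) // => /(_ isT isT t01)/or3P[].
  - by move=> h; left; apply: real.
  - by move=> h; right; apply: real.
  - by move/(rc_sub rc); rewrite (negbTE n01).
have [b0|nb0] := boolP (e v t0); have [b1|nb1] := boolP (e v t1); first by right.
- left; have v0 : adj v t0 by case: H => // /radj; rewrite (negbTE nb1).
  have at1 : adj t t1 by case: a1 => // -[_ E]; case/negP: nb1; rewrite E; apply/radj/(rc_head rc).
  have /andP[ht h0] := exit_heavy tT t0T t1T vt v0 tt0' at1 nb1 nu1 n01.
  exists t0; rewrite n0; split=> //; by rewrite -(perm_mem pZ) inE t0Z orbT.
- left; have v1 : adj v t1 by case: H => // /radj; rewrite (negbTE nb0).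
  have at0 : adj t t0 by case: a0 => // -[_ E]; case/negP: nb0; rewrite E; apply/radj/(rc_last rc).
  rewrite esym in n01.
  have /andP[ht h1] := exit_heavy tT t1T t0T vt v1 tt1' at0 nb0 nu0 n01.
  exists t; rewrite n1; split=> //.
  by rewrite -(perm_mem pZ) mem_head.
- by case: H => /radj; rewrite ?(negbTE nb0) ?(negbTE nb1).
Qed.

Lemma seg_split_next (f : rel G) (Z Z' : seq G) x y m p : uniq (Z ++ Z') ->
  seg f Z x y -> m \in Z -> m != y -> p = next (Z ++ Z') m ->
  exists U V, [/\ Z = U ++ V, seg f U x m & seg f V p y].
Proof.
move=> + sZ mZ my; case/splitPr: mZ sZ => U [|a V] sZ uZ pE.
  have [s' /eqP] := seg_lastE sZ.
  by rewrite cats1 eqseq_rcons => /andP[_ /eqP E]; rewrite E eqxx in my.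
rewrite -catA /= next_cat // in pE; last by rewrite -catA in uZ.
exists (rcons U m), (p :: V); rewrite -pE in sZ *; rewrite cat_rcons; split=> //.
  rewrite -cat_rcons in sZ; have n0 : rcons U m <> [::] by case: (U).
  case: (seg_catE n0 _ sZ) => // m' [? [s1 _ _]].
  by have [s' /eqP] := seg_lastE s1; rewrite eqseq_rcons => /andP[_ /eqP mE]; rewrite {2}mE.
rewrite -cat_rcons in sZ; have n0 : rcons U m <> [::] by case: (U).
case: (seg_catE n0 _ sZ) => // ? [p' [_ _ s2]].
have pp : p' = p by case/andP: s2 => /eqP.
by rewrite pp in s2.
Qed.

(** Such a [y] could spoil the wounded graphs whose arm ends at [u]. Without a heavy exit,
    [star_bypass] makes [crossing_path] applicable with the vertices joined to [v] and to [u] as [P]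
    and [Q], and its path is a forbidden one. *)
Lemma chord_heavy_exit t y : t \in T -> adj v t -> y \in T -> y != u -> ~~ adj v y ->
  adj t y -> e u y -> heavy_exit e v u c0.
Proof.
move=> tT vt yT yu nvy ty euy.
have evt := radj vt.
have [xl [yh [[sX sY xyh] [xlu uyh nvx nvh]]]] := linked_nbrs rc lu TE.
have tu : t != u by apply: contraTneq vt => ->; apply: (linked_nadj rc lu u_in).
have tc : t \in c0 by rewrite (c0_mem rc TE) tT.
have [Z [t1 [t0 [sZ tt1 t0t pZ nE]]]] := c0_rot rc lu TE sX sY xyh tc.
have uZ : uniq (t :: Z) by rewrite (perm_uniq pZ) (c0_uniq rc TE).
have u0 := c0_uniq rc TE.
have nvm : next c0 vm = vp.
  have sc := seg_cat sX xyh sY; have [s cE] := seg_headE sc.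
  have {1}<- : last vp s = vm by move: sc; rewrite cE => /and3P[_ _ /eqP].
  by rewrite cE next_last // -cE.
have n1 : next c0 t = t1 by have [Z' ZE] := seg_headE sZ; rewrite nE ZE /= eqxx.
have lZ : last t Z = t0 by have [Z' ->] := seg_lastE sZ; rewrite last_rcons.
have n0 : next c0 t0 = t by rewrite nE -lZ next_last.
have memc x : x \in Z -> x \in c0 by rewrite -(perm_mem pZ) inE => ->; rewrite orbT.
have a1 : adj t t1 \/ t = vm /\ t1 = vp.
  have := c0_next rc lu TE sX sY tc; rewrite n1 => -[|[]|[tx]]; [by left|by right|].
  by case/negP: nvx; rewrite -tx.
have a0 : adj t t0 \/ t = vp /\ t0 = vm.
  have := c0_next rc lu TE sX sY (memc _ (seg_last sZ)); rewrite n0 adj_sym.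
  case=> [|[]|[_ tx]]; [by left|by right|].
  by case/negP: nvh; rewrite -tx.
case: (star_bypass tT vt sZ tt1 t0t pZ a1 a0 n1 n0) => // HT; exfalso.
have final q b : perm_eq q (t :: Z) -> seg e q t b -> ~~ e u b.
  move=> pq sq; apply/negP; rewrite esym => h.
  exact: (no_spanning_path rc lu TE (perm_trans pq pZ) sq evt h).
have yZ : y \in Z.
  have : y \in c0 by rewrite (c0_mem rc TE) yT.
  by rewrite -(perm_mem pZ) inE eq_sym (negbTE (adj_neq ty)).
have yt1 : y != t1.
  apply: contraTneq euy => ->; apply: (final (t :: rev Z)); first by rewrite perm_cons perm_rev.
  by apply: seg_cons (seg_rev esym sZ); rewrite esym.
have yt0 : y != t0.
  by apply: contraTneq euy => ->; apply: (final (t :: Z)) (seg_cons tt1 sZ).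
have [Z1 [Z2 [y0 [y1 [ZE s1 y0y yy1 s2]]]]] := split_mem_seg sZ yZ yt1 yt0.
have y0c : y0 \in c0 by apply: memc; rewrite ZE mem_cat (seg_last s1).
have y1c : y1 \in c0 by apply: memc; rewrite ZE mem_cat inE (seg_head s2) !orbT.
have y01 : y0 != y1.
  move: uZ => /andP[_]; rewrite ZE => u2; apply/eqP => E.
  by case: (uniq_cat_disj u2 (seg_last s1)); rewrite E inE (seg_head s2) orbT.
have [t_y0 t_y1] : t != y0 /\ t != y1.
  case/andP: uZ => nt _; split; apply: contraNneq nt => ->; rewrite ZE mem_cat.
    by rewrite (seg_last s1).
  by rewrite inE (seg_head s2) !orbT.
have ny0 : next c0 y0 = y.
  rewrite nE; have [Z1' Z1E] := seg_lastE s1.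
  by move: uZ; rewrite ZE Z1E cat_rcons -cat_cons => uZ; rewrite next_cat.
have ny : next c0 y = y1.
  rewrite nE; have [Z2' Z2E] := seg_headE s2.
  by move: uZ; rewrite ZE Z2E -cat_cons => uZ; rewrite next_cat.
have yvp : y != vp by apply: contraNneq nvy => ->; apply: (rc_head rc).
have yvm : y != vm by apply: contraNneq nvy => ->; apply: (rc_last rc).
have HY : [|| e u y0, e u y1, e t y0, e t y1 | e y0 y1].
  have := c0_next rc lu TE sX sY y0c; rewrite ny0 => -[y0a|[_ E]|[E _]]; last 2 first.
  - by rewrite E eqxx in yvp.
  - by rewrite E esym radj.
  have yc := memc _ yZ.
  have := c0_next rc lu TE sX sY yc; rewrite ny => -[y1a|[E _]|[_ E]]; last 2 first.
  - by rewrite E eqxx in yvm.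
  - by have -> : e u y1; [rewrite E; exact: radj|rewrite orbT].
  rewrite adj_sym in ty; rewrite adj_sym in y0a.
  have := claw_hadj (rc_claw rc) ty y0a y1a t_y0 t_y1 y01.
  by case/or3P=> /(rc_sub rc) ->; rewrite ?orbT.
have HC : [\/ e v t0, e v t1 | exists m p U V, [/\ e m t, e v p &
       [/\ Z1 = U ++ V, seg e U t1 m & seg e V p y0] \/
       [/\ Z2 = U ++ V, seg e U y1 m & seg e V p t0]]].
  have [tm|ntm] := eqVneq t vm.
    by constructor 2; rewrite -n1 tm nvm; apply/radj/(rc_head rc).
  have [tp|ntp] := eqVneq t vp.
    constructor 1; have -> : t0 = vm; last exact/radj/(rc_last rc).
    by apply: (can_inj (prev_next u0)); rewrite n0 nvm.
  (* The cycle is opened at the pair that bypasses [v]: [vm] is joined to [t] by [star_clique], and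
     [vp] to [v]. *)
  constructor 3; exists vm, vp.
  have etm : e vm t.
    rewrite eq_sym in ntm.
    exact/(rc_sub rc)/(star_clique rc zw vz (rc_vm rc) tT (rc_last rc) vt ntm).
  have nZ m : m \in Z1 ++ y :: Z2 -> next (t :: Z) m = next c0 m by rewrite nE.
  have : vm \in Z1 ++ y :: Z2.
    have : vm \in t :: Z.
      by rewrite (perm_mem pZ) (c0_mem rc TE) (rc_vm rc); have [_] := linked_ends rc lu; rewrite eq_sym.
    by rewrite inE eq_sym (negbTE ntm) ZE.
  rewrite mem_cat inE eq_sym (negbTE yvm) /= => /orP[m1|m2].
    have m0 : vm != y0 by apply: contraNneq yvp => E; rewrite -ny0 -E nvm.
    have pE : vp = next (Z1 ++ (y :: Z2 ++ [:: t])) vm.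
      rewrite -nvm nE ZE -(next_rot 1) //; last by rewrite -ZE.
      by rewrite rot1_cons -cats1 -catA.
    have u1 : uniq (Z1 ++ (y :: Z2 ++ [:: t])).
      by have := uZ; rewrite -(rot_uniq 1) rot1_cons ZE -cats1 -catA.
    have [U [V [h1 h2 h3]]] := seg_split_next u1 s1 m1 m0 pE.
    by exists U, V; split; [by []|exact/radj/(rc_head rc)|by left].
  have m0 : vm != t0 by apply: contraNneq ntp => E; rewrite -n0 -E nvm.
  have LE : t :: Z1 ++ y :: Z2 = (t :: Z1 ++ [:: y]) ++ Z2 by rewrite /= -catA.
  have pE : vp = next (Z2 ++ (t :: Z1 ++ [:: y])) vm.
    rewrite -nvm nE -(next_rot (size (t :: Z1 ++ [:: y]))) // ZE.
    by rewrite LE rot_size_cat.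
  have u2 : uniq (Z2 ++ (t :: Z1 ++ [:: y])).
    have := uZ; rewrite -(rot_uniq (size (t :: Z1 ++ [:: y]))) ZE.
    by rewrite LE rot_size_cat.
  have [U [V [h1 h2 h3]]] := seg_split_next u2 s2 m2 m0 pE.
  by exists U, V; split; [by []|exact/radj/(rc_head rc)|by right].
have [q [a [b [pq sq va ub]]]] :=
  crossing_path esym tt1 s1 y0y yy1 s2 t0t evt euy (radj ty) HT HY HC.
rewrite -ZE in pq; rewrite esym in ub.
exact: (no_spanning_path rc lu TE (perm_trans pq pZ) sq va ub).
Qed.

End Chord.

(** * Distance classes *)

Section Layers.
Variables (G : sgraph) (e0 : rel G) (v : G) (T w : seq G).
Hypothesis rc0 : rooted_cycle e0 v T w.
Implicit Types (x y t l : G) (B L : {set G}).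
Local Notation vp := (head v T).
Local Notation vm := (last v T).
Local Notation C := (v :: T).
Variables (u : G) (X Y : seq G) (F : {set G}) (z c1 : G).
Hypotheses (lu : linked w v u) (TE : T = X ++ u :: Y).
Hypothesis hF : forall x y, e0 x y -> hadj x y || (x \in F) && (y \in F).
Hypothesis hFu : forall f, f \in F -> f = u \/ e0 u f.
Hypothesis hw : forall x p, p \in w -> adj x p -> linked w v x.
Hypotheses (zw : z \in w) (vz : adj v z) (zc : adj z c1) (nvc : ~~ adj v c1).
Hypothesis hc1 : c1 = u \/ c1 \in w.
Hypothesis hvu : heavy v -> heavy u.
Local Notation c0 := (X ++ Y).

Lemma rc_extend e : symmetric e -> subrel e0 e -> maximal_cycle e C w ->
  rooted_cycle e v T w.
Proof.
by move=> es sub m; case: rc0 => *; split=> // x y h; apply: sub; apply: rc_sub rc0 _ _ h.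
Qed.

(* [B] collects the distance classes from [v] inside the cycle, up to the class [L];
   [l] belongs to the class before [L]. *)
Record layered B L l : Prop := Layered {
  lay_sub : {subset B <= C};
  lay_v : v \in B;
  lay_vp : vp \in B;
  lay_vm : vm \in B;
  lay_L : {subset L <= B};
  lay_vL : v \notin L;
  lay_closed : forall x y, x \in B -> x \notin L -> y \in C -> adj x y -> y \in B;
  lay_clique : {in L &, forall s t, s != t -> hadj s t};
  lay_top : forall t, t \in L -> adj l t;
  lay_lB : l \in B;
  lay_lL : l \notin L;
  lay_light : ~~ heavy l \/
    forall y t, y \in C -> y \notin B -> t \in L -> adj t y -> ~~ heavy y;
  lay_max : maximal_cycle (clique_on e0 B) C w }.

Section Layer.
Variables (B L : {set G}) (l : G).
Hypothesis lay : layered B L l.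
Local Notation e := (clique_on e0 B).

Let esym : symmetric e := clique_on_sym B (rc_sym rc0).

Lemma lay_rc : rooted_cycle e v T w.
Proof. by apply: rc_extend => //; [exact: sub_clique_on | exact: (lay_max lay)]. Qed.

Lemma lay_clq x y : x \in B -> y \in B -> x != y -> e x y.
Proof. by move=> xB yB xy; rewrite /clique_on xB yB xy orbT. Qed.

Lemma lay_out x y : y \notin B -> e x y = e0 x y.
Proof. by move=> /negbTE yB; rewrite /clique_on yB !andbF orbF. Qed.

(** In the claw at [s] with leaves [l], [x], [y], [lay_closed] forbids edges from [l] to [x] and
    [y], and [lay_light] forbids heavy pairs there. *)
Lemma lay_next (s x y : G) : s \in L -> x \in C -> y \in C -> x \notin B -> y \notin B ->
  adj s x -> adj s y -> x != y -> hadj x y.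
Proof.
move=> sL xC yC xB yB sx sy xy.
have far a : a \in C -> a \notin B -> adj s a -> ~~ hadj l a.
  move=> aC aB sa; apply/negP => /orP[la|/and3P[_ hl ha]].
    by case/negP: aB; apply: (lay_closed lay) la; [exact: (lay_lB lay)|exact: (lay_lL lay)|].
  by case: (lay_light lay) => [|h]; [rewrite hl|case/negP: (h a s aC aB sL sa)].
have nl a : a \notin B -> l != a by apply: contraNneq => <-; apply: (lay_lB lay).
have sl : adj s l by rewrite adj_sym; apply: (lay_top lay).
have := claw_hadj (rc_claw rc0) sl sx sy (nl _ xB) (nl _ yB) xy.
by rewrite (negbTE (far x _ _ _)) // (negbTE (far y _ _ _)).
Qed.

Lemma lay_T (s : G) : s \in B -> s != v -> s \in T.
Proof. by move=> sB sv; have := lay_sub lay sB; rewrite inE (negbTE sv). Qed.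

Lemma lay_unlinked s : s \in B -> s != v -> ~ linked w v s.
Proof.
move=> sB sv ls; have [X' [Y' TE']] := mem_split (lay_T sB sv).
have [sp _] := linked_ends lay_rc ls.
by have /negP := linked_vp lay_rc ls TE'; apply; apply: lay_clq => //; apply: (lay_vp lay).
Qed.

(** For [linked_avoid], a neighbour of [s] inside [B] is joined to [v], and two neighbours outside
    [B] are joined by [lay_next]. *)
Lemma lay_avoid y s : linked w v y -> y \in T -> s \in B -> s != v -> ~~ e y s.
Proof.
move=> ly yT sB sv; have [X' [Y' TE']] := mem_split yT.
apply: (linked_avoid lay_rc ly TE' (lay_T sB sv)).
- by apply/eqP => sy; apply: (lay_unlinked sB sv); rewrite sy.
- by apply: lay_clq => //; [exact: (lay_v lay) | rewrite eq_sym].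
- have [->|sm] := eqVneq s vm; [by left|right].
  by apply: lay_clq => //; apply: (lay_vm lay).
move=> s0 s1 s0C s1C s01 ss0 ss1 s0v s1v.
have [s0B|s0B] := boolP (s0 \in B).
  by constructor 1; apply: lay_clq => //; [exact: (lay_v lay) | rewrite eq_sym].
have [s1B|s1B] := boolP (s1 \in B).
  by constructor 2; apply: lay_clq => //; [exact: (lay_v lay) | rewrite eq_sym].
constructor 3; have [sL|sL] := boolP (s \in L).
  by apply/(rc_sub lay_rc)/(lay_next sL).
by case/negP: s0B; apply: (lay_closed lay) ss0.
Qed.

Lemma lay_u s : s \in B -> s != v -> ~~ e u s.
Proof. by apply: lay_avoid lu _; rewrite TE mem_cat inE eqxx orbT. Qed.

(** Hence the pairs added on the side of [u] do not touch the classes around [v], where [e0] reduces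
    to the closure. *)
Lemma lay_notF s : s \in B -> s != v -> s \notin F.
Proof.
move=> sB sv; apply/negP => /hFu[su|us]; last first.
  by have /negP := lay_u sB sv; apply; apply: sub_clique_on.
by apply: (lay_unlinked sB sv); rewrite su.
Qed.

Lemma lay_e0 s p : s \in B -> s != v -> e0 s p -> hadj s p.
Proof. by move=> sB sv /hF; rewrite (negbTE (lay_notF sB sv)) orbF. Qed.

Lemma lay_adjw s p : s \in B -> s != v -> p \in w -> ~~ adj s p.
Proof. by move=> sB sv pw; apply/negP => /(hw pw)/(lay_unlinked sB sv). Qed.

Definition next_layer := [set y in C | (y \notin B) && [exists t in L, adj t y]].

Lemma next_layerP y : y \in next_layer ->
  [/\ y \in C, y \notin B & exists2 t, t \in L & adj t y].
Proof. by rewrite inE => /and3P[yC yB /exists_inP]. Qed.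

Lemma mem_next_layer y t : y \in C -> y \notin B -> t \in L -> adj t y -> y \in next_layer.
Proof. by move=> yC yB tL ty; rewrite inE yC yB; apply/exists_inP; exists t. Qed.

(** Since [xl] and [yh] are not joined to [v], the cycle leaves [B] both along [X] from [vp] and
    backwards along [Y] from [vm]. As [X] and [Y] are disjoint, the next class has two vertices. *)
Lemma lay_exits : exists a b b' q q', [/\ b \in L, b' \in L, q \in next_layer,
   q' \in next_layer & q != q'] /\
   [/\ a \in c0, a \in B, a != v & next c0 a = b].
Proof.
have [xl [yh [[sX sY xyh] [xlu uyh nvx nvh]]]] := linked_nbrs lay_rc lu TE.
have [xl' [yh' [sX' _ _ sY']]] := linked_split lay_rc lu TE.
have [_ xE] := seg_eq sX' sX; have [yE _] := seg_eq sY' sY; rewrite {}xE {}yE in sX' sY'.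
have inT x : x \in c0 -> x \in T by rewrite (c0_mem lay_rc TE) => /andP[].
have nv x : x \in c0 -> x != v by move=> /inT; apply: (rc_vNT lay_rc).
have xlB : xl \notin B.
  apply: contra nvx => xB; apply: lay_clq => //; first exact: (lay_v lay).
  by rewrite eq_sym nv // mem_cat (seg_last sX).
have yhB : yh \notin B.
  apply: contra nvh => yB; apply: lay_clq => //; first exact: (lay_v lay).
  by rewrite eq_sym nv // mem_cat (seg_head sY) orbT.
have key (s : seq G) x y : seg (@adj G) s x y -> x \in B -> y \notin B -> {subset s <= c0} ->
    exists s1 b q s2, [/\ s = rcons s1 b ++ q :: s2, all (fun x => x \in B) (rcons s1 b),
      b \in L & q \in next_layer].
  move=> ss xB yB sub.
  have [s1 [q [s2 [sE aB qB]]]] := split_prefix (P := fun x => x \in B) (seg_last ss) yB.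
  have s10 : s1 <> [::].
    by move=> s10; move: ss qB; rewrite sE s10 => /and3P[/eqP-> _ _]; rewrite xB.
  have ss' : seg (@adj G) (s1 ++ q :: s2) x y by rewrite -sE.
  case: (seg_catE s10 _ ss') => // b [q0 [h1 bq h2]].
  have qq : q0 = q by case/andP: h2 => /eqP->.
  rewrite {}qq in bq; have [s1' s1E] := seg_lastE h1.
  have qs : q \in s by rewrite sE mem_cat mem_head orbT.
  have qC : q \in C by rewrite inE inT ?orbT // sub.
  have bB : b \in B by apply: (allP aB); rewrite s1E mem_rcons mem_head.
  have bL : b \in L.
    by apply: contraR qB => bL; apply: (lay_closed lay) bq.
  exists s1', b, q, s2; rewrite -s1E; split=> //.
  exact: mem_next_layer bL bq.
have [s1 [b [q [s2 [XE aB bL qN]]]]] : exists s1 b q s2, [/\ X = rcons s1 b ++ q :: s2,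
    all (fun x => x \in B) (rcons s1 b), b \in L & q \in next_layer].
  apply: (key X vp xl) => //; first exact: (lay_vp lay).
  by move=> x xX; rewrite mem_cat xX.
have [r1 [b' [q' [r2 [YE _ bL' qN']]]]] : exists s1 b q s2,
    [/\ rev Y = rcons s1 b ++ q :: s2,
    all (fun x => x \in B) (rcons s1 b), b \in L & q \in next_layer].
  apply: (key (rev Y) vm yh) => //; [exact: seg_rev (@adj_sym G) sY'|exact: (lay_vm lay)|].
  by move=> x; rewrite mem_rev mem_cat => ->; rewrite orbT.
have qX : q \in X by rewrite XE mem_cat mem_head orbT.
have qY : q' \in Y by rewrite -mem_rev YE mem_cat mem_head orbT.
have u0 := c0_uniq lay_rc TE.
have qq : q != q' by apply/eqP => E; apply: (uniq_cat_disj u0 qX); rewrite E.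
(* If the cycle leaves [B] right after [vp], the predecessor of [b] on the bypassed cycle is
   [vm]. *)
case/lastP: s1 => [|s1 a] in XE aB *.
  exists vm, b, b', q, q'; split; split=> //.
  - by rewrite mem_cat (seg_last sY) orbT.
  - exact: (lay_vm lay).
  - exact: rc_vNT lay_rc _ (rc_vm lay_rc).
  have sc := seg_cat sX xyh sY; have [c cE] := seg_headE sc.
  have {1}<- : last vp c = vm by move: sc; rewrite cE => /and3P[_ _ /eqP].
  rewrite cE next_last -?cE //; move: cE; rewrite XE /= => -[->].
  by [].
exists a, b, b', q, q'; have aX : a \in X by rewrite XE mem_cat !(mem_rcons, inE) eqxx !orbT.
have ac : a \in c0 by rewrite mem_cat aX.
split; split=> //; last 2 first.
- exact: nv.
- move: u0; rewrite XE -!cats1 -!catA /= => u0; exact: next_cat.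
by apply: (allP aB); rewrite !(mem_rcons, inE) eqxx orbT.
Qed.

Lemma lay_final : {in L, forall t, heavy t} -> heavy_exit e v u c0.
Proof.
move=> hL; have [a [b [_ [_ [_ [[bL _ _ _ _] [ac aB av nab]]]]]]] := lay_exits.
have bB := lay_L lay bL.
have bv : b != v by apply: contraNneq (lay_vL lay) => <-.
exists a; rewrite nab; split=> //.
- by apply: lay_clq => //; [exact: (lay_v lay) | rewrite eq_sym].
- by apply: lay_clq => //; [exact: (lay_v lay) | rewrite eq_sym].
- exact: hL.
- exact: lay_u.
Qed.

End Layer.

(* [l], [b], [c] form the long arm of wounded graphs whose triangle consists of [l]
   and two vertices of [L]. *)
Record anchored B L l (b c : G) : Prop := Anchored {
  anc_lay : layered B L l;
  anc_two : exists s t, [/\ s \in L, t \in L & s != t];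
  anc_lb : adj l b;
  anc_bc : adj b c;
  anc_lc : ~~ adj l c;
  anc_L : forall t, t \in L -> ~~ adj t b && ~~ adj t c;
  anc_next : forall y, y \in next_layer B L -> ~~ adj y b && ~~ adj y c;
  anc_light : ~~ heavy b || ~~ heavy l && ~~ heavy c;
  anc_inner : (b \in B) && (b \notin L) \/ b \in w }.

Section Step.
Variables (B L : {set G}) (l b c : G).
Hypothesis anc : anchored B L l b c.
Let lay := anc_lay anc.
Local Notation e := (clique_on e0 B).
Local Notation N := (next_layer B L).

Lemma anc_far y : y \in N -> ~~ adj y l.
Proof.
case/next_layerP=> yC yB _; rewrite adj_sym; apply: contra yB.
by apply: (lay_closed lay) => //; [exact: (lay_lB lay)|exact: (lay_lL lay)].
Qed.

(** The chain here is [c], [l], [y], [t'], [b], [t]. A light [b] makes [t] and [t'] heavy; the other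
    alternative of [anc_light] contradicts the pair [c], [l]. *)
Lemma anc_wounded t t' y : t \in L -> t' \in L -> adj t t' -> y \in N -> adj t y ->
  adj t' y || heavy t && heavy t'.
Proof.
move=> tL t'L tt' yN ty; have [//|nty] := boolP (adj t' y); rewrite /=.
have [lt lt'] := (lay_top lay tL, lay_top lay t'L).
have /andP[tb tc] := anc_L anc tL; have /andP[t'b t'c] := anc_L anc t'L.
have /andP[yb yc] := anc_next anc yN; have yl := anc_far yN.
rewrite adj_sym in yl; rewrite adj_sym in yb.
have [] := wounded_heavy (rc_wounded rc0) lt tt' lt' (anc_lb anc) (anc_bc anc) ty
  yl (anc_lc anc) tb tc t'b nty t'c yb yc.
have := anc_light anc; case: (heavy b) => /=; last by rewrite orbF => _ _ _ _ -> ->.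
by case/andP=> /negbTE-> /negbTE->.
Qed.

Variable t0 : G.
Hypotheses (t0L : t0 \in L) (t0_light : ~~ heavy t0).

(** The light [t0] is adjacent in G to the rest of [L], so by [anc_wounded] adjacency to [y] passes
    to [t0] and from it to all of [L]. *)
Lemma anc_complete y t : y \in N -> t \in L -> adj t y.
Proof.
move=> yN; have [_ _ [t1 t1L t1y]] := next_layerP yN.
have t0t x : x \in L -> x != t0 -> adj t0 x.
  move=> xL xt; apply: hadj_light t0_light _; apply: (lay_clique lay) => //.
  by rewrite eq_sym.
have t0y : adj t0 y.
  have [<-//|t10] := eqVneq t1 t0.
  have t1t0 : adj t1 t0 by rewrite adj_sym t0t.
  by have := anc_wounded t1L t0L t1t0 yN t1y; rewrite (negbTE t0_light) andbF orbF.
move=> tL; have [->//|tt0] := eqVneq t t0.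
by have := anc_wounded t0L tL (t0t _ tL tt0) yN t0y; rewrite (negbTE t0_light) orbF.
Qed.

Lemma next_clique : {in N &, forall x y, x != y -> hadj x y}.
Proof.
move=> x y xN yN xy; have [xC xB _] := next_layerP xN; have [yC yB _] := next_layerP yN.
by apply: (lay_next lay t0L) => //; apply: anc_complete.
Qed.

Lemma anc_v t : t \in L -> t != v.
Proof. by move=> tL; apply: contraNneq (lay_vL lay) => <-. Qed.

(* The two vertices of [L] used to close up paths need not both be light: only the
   light one has all its neighbours in [B] and the next class. *)
Lemma next_max : maximal_cycle (clique_on e0 (B :|: N)) C w.
Proof.
have [s [s' [sL s'L ss']]] := anc_two anc.
have [t1 [t1L t10]] : exists t1, t1 \in L /\ t0 != t1.
  by have [E|] := eqVneq t0 s; [exists s'; rewrite E | exists s].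
have [t0B t1B] := (lay_L lay t0L, lay_L lay t1L).
have [t0v t1v] := (anc_v t0L, anc_v t1L).
have esym : symmetric e := clique_on_sym B (rc_sym rc0).
have Csize : 2 < size C by have := rc_size rc0.
have mj : maximal_cycle (clique_on e (B :|: N)) C w.
  apply: (maximal_cycle_join esym (rc_uniq rc0) Csize (lay_max lay) (lay_sub lay)
    _ _ _ _ t0B t1B t10).
  - by move=> y /next_layerP[].
  - by move=> y /next_layerP[].
  - by move=> x y xB yB; apply: lay_clq.
  - by move=> x y xN yN xy; apply/sub_clique_on/(rc_sub rc0)/next_clique.
  - move=> y yN; rewrite !sub_clique_on //; apply/(rc_adj rc0)/anc_complete => //.
  - move=> p pCw t0p; have [//|pB] := boolP (p \in B); rewrite lay_out // in t0p.
    have {}t0p : adj t0 p by apply: hadj_light t0_light (lay_e0 lay t0B t0v t0p).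
    move: pCw; rewrite mem_cat => /orP[pC|pw]; last first.
      by have := lay_adjw lay t0B t0v pw; rewrite t0p.
    exact: mem_next_layer t0L t0p.
  - have nb p : p \in C ++ w -> e t1 p -> p \notin B -> p \notin N -> heavy p.
      move=> pCw t1p pB pN; rewrite lay_out // in t1p.
      have /orP[a|/and3P[_ _ //]] := lay_e0 lay t1B t1v t1p; exfalso.
      move: pCw; rewrite mem_cat => /orP[pC|pw].
        by case/negP: pN; apply: mem_next_layer t1L a.
      by have := lay_adjw lay t1B t1v pw; rewrite a.
    move=> p p' pC pC' e1 e2 pp pB pB' pN pN'.
    by apply/sub_clique_on/(rc_sub rc0)/heavy_hadj => //; [exact: nb e1 _ _|exact: nb e2 _ _].
apply: maximal_cycle_sub mj => x y; rewrite /clique_on => /orP[->//|->].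
by rewrite orbT.
Qed.

Lemma next_layered : layered (B :|: N) N t0.
Proof.
have NB y : y \in N -> y \notin B by case/next_layerP.
split.
- by move=> x; rewrite inE => /orP[/(lay_sub lay)//|/next_layerP[]].
- by rewrite inE (lay_v lay).
- by rewrite inE (lay_vp lay).
- by rewrite inE (lay_vm lay).
- by move=> x xN; rewrite inE xN orbT.
- by apply: contraL (lay_v lay); apply: NB.
- move=> x y; rewrite inE => /orP[xB _ yC xy|-> //]; rewrite inE.
  have [//|yB] := boolP (y \in B); apply: (mem_next_layer yC yB _ xy).
  by apply: contraR yB => xL; apply: (lay_closed lay) xy.
- exact: next_clique.
- by move=> t tN; apply: anc_complete.
- by rewrite inE (lay_L lay).
- by apply: contraL (lay_L lay t0L); apply: NB.
- by left.
- exact: next_max.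
Qed.

Lemma next_anchored : anchored (B :|: N) N t0 l b.
Proof.
have layN := next_layered.
have lBN : (l \in B :|: N) && (l \notin N).
  rewrite inE (lay_lB lay) /=; apply/negP => /next_layerP[_].
  by rewrite (lay_lB lay).
split=> //.
- have [_ [_ [_ [q [q' [[_ _ h1 h2 h3] _]]]]]] := lay_exits lay.
  by exists q, q'.
- by rewrite adj_sym; apply: (lay_top lay).
- exact: (anc_lb anc).
- by have /andP[] := anc_L anc t0L.
- by move=> y yN; rewrite anc_far //=; have /andP[] := anc_next anc yN.
- move=> y /next_layerP[yC yBN [t tN ty]].
  have closed x : x \in B :|: N -> x \notin N -> ~~ adj y x.
    move=> xB xN; apply: contra yBN; rewrite adj_sym => xy.
    exact: (lay_closed layN) xy.
  have /andP[lB lN] := lBN; rewrite closed //=.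
  case: (anc_inner anc) => [/andP[bB bL]|bw].
    apply: closed; first by rewrite inE bB.
    by apply/negP => /next_layerP[_]; rewrite bB.
  apply/negP => yb; have ly := hw bw yb.
  have yv : y != v by apply: contraNneq yBN => ->; apply: (lay_v layN).
  have yT : y \in T by move: yC; rewrite inE (negbTE yv).
  have tB := lay_L layN tN.
  have tv : t != v by apply: contraNneq (lay_vL layN) => <-.
  have /negP := lay_avoid layN ly yT tB tv; apply; apply: sub_clique_on.
  by apply: (rc_adj rc0); rewrite adj_sym.
(* The condition reproduces itself along the new arm [t0], [l], [b]: if [b] is light, so are both
   [t0] and [b]; if [b] is heavy, the old condition makes [l] light. *)
- by move: (anc_light anc); rewrite t0_light /=; case: (heavy b) => /= [/andP[->]|_] //; rewrite orbT.
- by left.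
Qed.

End Step.
Lemma anchored_exit B L l b c : anchored B L l b c ->
  exists B', [/\ rooted_cycle (clique_on e0 B') v T w, v \in B' &
    heavy_exit (clique_on e0 B') v u c0].
Proof.
have [n] := ubnP #|~: B|; elim: n => // n IH in B L l b c * => nB anc.
have lay := anc_lay anc.
have [/forall_inP hL|] := boolP [forall t in L, heavy t].
  by exists B; split; [exact: lay_rc lay|exact: lay_v lay|apply: lay_final lay _ => t /hL].
rewrite negb_forall => /existsP[t0]; rewrite negb_imply => /andP[t0L t0l].
apply: IH (next_anchored anc t0L t0l); apply: (@leq_trans #|~: B|) => //.
apply: proper_card; apply/properP; split.
  by rewrite setCS subsetUl.
have [_ [_ [_ [q [_ [[_ _ qN _ _] _]]]]]] := lay_exits lay.
by exists q; [rewrite in_setC; case/next_layerP: qN|rewrite in_setC in_setU qN orbT].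
Qed.

Definition star := [set s in T | adj v s].

(** A chord as in [chord_heavy_exit] gives the exit at once. Without such chords the arm from [v]
    through [z] to [c1] is usable even when it ends at [u], and the classes start from the
    neighbours of [v]. *)
Lemma star_exit : exists e B, [/\ rooted_cycle e v T w, v \in B,
   [/\ subrel e0 e, forall x y, e x y -> e0 x y || (x \in B) && (y \in B) &
       forall f, f \in B -> f = v \/ e v f] & heavy_exit e v u c0].
Proof.
have uT : u \in T by rewrite TE mem_cat inE eqxx orbT.
have hc1' : c1 = u \/ forall x, x \in T -> adj x c1 -> linked w v x.
  by case: hc1 => [->|cw]; [left|right=> x _; apply: hw].
have [/existsP[t /existsP[y /and5P[tT vt yT yu /and3P[nvy ty uy]]]]|nchord] :=
  boolP [exists t, exists y, [&& t \in T, adj v t, y \in T, y != u &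
    [&& ~~ adj v y, adj t y & e0 u y]]].
  exists e0, [set v]; split; rewrite ?inE //.
    split=> // [a b ->//|f]; by rewrite inE => /eqP; left.
  exact: (chord_heavy_exit rc0 lu TE zw vz zc nvc hc1' hvu tT vt yT yu nvy ty uy).
have starP s : s \in star -> s \in T /\ adj v s by rewrite inE => /andP.
have nextP y : y \in next_layer (v |: star) star ->
    [/\ y \in T, ~~ adj v y, y != u & ~~ e0 u y].
  case/next_layerP=> yC; rewrite !inE => /norP[yv].
  have yT : y \in T by move: yC; rewrite inE (negbTE yv).
  rewrite yT /= => nvy [t /starP[tT vt] ty].
  have nut := star_avoid rc0 lu uT tT vt.
  have yu : y != u.
    by apply: contraNneq nut => <-; apply: (rc_adj rc0); rewrite adj_sym.
  split=> //; apply: contra nchord => uy; apply/existsP; exists t; apply/existsP; exists y.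
  by rewrite tT vt yT yu nvy ty uy.
have lay : layered (v |: star) star v.
  split.
  - by move=> x; rewrite !inE => /orP[->//|/andP[->]]; rewrite orbT.
  - by rewrite !inE eqxx.
  - by rewrite !inE (rc_vp rc0) (rc_head rc0) orbT.
  - by rewrite !inE (rc_vm rc0) (rc_last rc0) orbT.
  - by move=> x xS; rewrite inE xS orbT.
  - by rewrite inE adj_irrefl andbF.
  - move=> x y; rewrite inE => /orP[|-> //]; rewrite inE => /eqP-> _ yC vy.
    rewrite !inE vy andbT; move: yC; rewrite inE.
    by case: eqP => // yv; rewrite yv adj_irrefl in vy.
  - move=> s t /starP[sT vs] /starP[tT vt]; exact: (star_clique rc0 zw vz).
  - by move=> t /starP[].
  - by rewrite !inE eqxx.
  - by rewrite inE adj_irrefl andbF.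
  (* If [v] is heavy then so is [u], and a heavy [y] would be joined to [u], giving an excluded
     chord. *)
  - have [/hvu hu|] := boolP (heavy v); [right|by left].
    move=> y t yC yB tL ty; have [yT nvy yu] := nextP y (mem_next_layer yC yB tL ty).
    by apply: contra => hy; apply/(rc_sub rc0)/heavy_hadj; rewrite // eq_sym.
  - apply: maximal_cycle_sub (rc_max rc0) => x y /orP[//|/and3P[xy]].
    rewrite !in_setU1 => /orP[/eqP xv|/starP[xT vx]] /orP[/eqP yv|/starP[yT vy]].
    + by rewrite xv yv eqxx in xy.
    + by rewrite xv; apply: (rc_adj rc0).
    + by rewrite yv (rc_sym rc0); apply: (rc_adj rc0).
    + by apply/(rc_sub rc0)/(star_clique rc0 zw vz).
have anc : anchored (v |: star) star v z c1.
  have nlink y : y \in T -> ~~ adj v y -> y \in next_layer (v |: star) star -> ~ linked w v y.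
    move=> yT nvy /next_layerP[_ _ [t /starP[tT vt] ty]] ly.
    have /negP := star_avoid rc0 ly yT tT vt; apply; apply: (rc_adj rc0).
    by rewrite adj_sym.
  split=> //.
  - exists vp, vm; rewrite !inE (rc_vp rc0) (rc_head rc0) (rc_vm rc0) (rc_last rc0).
    by split=> //; apply: rc_vpm rc0.
  - move=> t /starP[tT vt]; apply/andP; split; apply/negP => h.
      by have /negP := linked_nadj rc0 (hw zw h) tT.
    case: hc1' => [E|hl]; last by have /negP := linked_nadj rc0 (hl _ tT h) tT.
    have /negP := star_avoid rc0 lu uT tT vt; apply; apply: (rc_adj rc0).
    by rewrite adj_sym -E.
  - move=> y yN; have [yT nvy yu nuy] := nextP y yN.
    apply/andP; split; apply/negP => h; first exact: (nlink y yT nvy yN (hw zw h)).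
    case: hc1' => [E|hl]; last exact: (nlink y yT nvy yN (hl _ yT h)).
    by case/negP: nuy; apply: (rc_adj rc0); rewrite adj_sym -E.
  - by rewrite (rc_light rc0 zw).
  - by right.
have [B [rcB vB hB]] := anchored_exit anc.
exists (clique_on e0 B), B; split=> //; split.
- exact: sub_clique_on.
- by move=> x y /orP[->//|/and3P[_ -> ->]]; rewrite orbT.
- move=> f fB; have [->|fv] := eqVneq f v; [by left|right].
  by rewrite /clique_on vB fB eq_sym fv orbT.
Qed.

End Layers.

(** * Exchanging the two ends of the outer path *)

Section Flip.
Variables (G : sgraph) (w : seq G).
Implicit Types (e : rel G) (v u x y z : G) (X Y : seq G).

Lemma linked_sym x y : linked w x y -> linked w y x.
Proof.
case=> w' [z [z' [uw sw sz xz zy]]]; exists (rev w'), z', z; split.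
- by rewrite rev_uniq.
- by move=> a; rewrite mem_rev; apply: sw.
- exact: seg_rev (@adj_sym G) sz.
- by rewrite adj_sym.
- by rewrite adj_sym.
Qed.

Lemma perm_flip v u X Y : perm_eq (v :: X ++ u :: Y) (u :: Y ++ v :: X).
Proof. by perm_by_count. Qed.

(** The cycle is rotated, not reversed, so that successors are the same from both roots. *)
Lemma rc_flip e v u X Y : rooted_cycle e v (X ++ u :: Y) w -> linked w v u ->
  rooted_cycle e u (Y ++ v :: X) w.
Proof.
move=> rc lu; have [xl [yh [sX xu uy sY]]] := linked_split rc lu erefl.
have hl : head u (Y ++ v :: X) = yh by have [? ->] := seg_headE sY.
have ll : last u (Y ++ v :: X) = xl.
  by have [? ->] := seg_lastE sX; rewrite last_cat /= last_rcons.
have memE := perm_mem (perm_flip v u X Y).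
split; rewrite ?hl ?ll //.
- exact: rc_claw rc.
- exact: rc_wounded rc.
- exact: rc_sym rc.
- exact: rc_sub rc.
- by rewrite -(perm_uniq (perm_flip v u X Y)); apply: rc_uniq rc.
- by have := rc_size rc; rewrite !size_cat /= !addnS addnC.
- apply: seg_cat sY _ (seg_cons (rc_head rc) sX).
  by have := rc_last rc; rewrite adj_sym.
- by rewrite adj_sym.
- by move=> x /(rc_heavy rc); rewrite memE.
- by move=> z /(rc_out rc); rewrite memE.
- by apply: maximal_cycle_mem (rc_max rc) => // x; rewrite memE.
Qed.

(** Chooses [c1] as the second vertex of [w], not adjacent to [v] by minimality, or as [u] if [w]
    has one vertex, not adjacent to [v] by [linked_nadj]. *)
Lemma side_exit e0 v u X Y (F : {set G}) z z' :
  rooted_cycle e0 v (X ++ u :: Y) w -> uniq w -> seg (@adj G) w z z' -> adj v z -> adj z' u ->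
  (forall w' a b, {subset w' <= w} -> uniq w' -> seg (@adj G) w' a b -> adj v a -> adj b u ->
     size w <= size w') ->
  (forall x y, e0 x y -> hadj x y || (x \in F) && (y \in F)) ->
  (forall f, f \in F -> f = u \/ e0 u f) ->
  (heavy v -> heavy u) ->
  exists e (B : {set G}), [/\ rooted_cycle e v (X ++ u :: Y) w, v \in B,
   [/\ subrel e0 e, forall x y, e x y -> e0 x y || (x \in B) && (y \in B) &
       forall f, f \in B -> f = v \/ e v f] & heavy_exit e v u (X ++ Y)].
Proof.
move=> rc uw sw vz zu wmin hF hFu hvu.
have lu : linked w v u by exists w, z, z'; split.
have [w2 wE] := seg_headE sw; have zw := seg_head sw.
have hw x p : p \in w -> adj x p -> linked w v x.
  move=> pw xp; have [w3 [w4 wE']] : exists w3 w4, w = rcons w3 p ++ w4.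
    by case/splitPr: pw => w3 w4; exists w3, w4; rewrite cat_rcons.
  have sub : {subset rcons w3 p <= w} by move=> a; rewrite wE' mem_cat => ->.
  have u3 : uniq (rcons w3 p) by move: uw; rewrite wE' cat_uniq => /andP[].
  have s3 : seg (@adj G) (rcons w3 p) z p.
    case: w4 wE' => [|p' w4] wE'.
      rewrite cats0 in wE'; rewrite -wE' in sub u3 *.
      have [w5 wE5] := seg_lastE sw; move: wE'; rewrite wE5 => /eqP.
      by rewrite eqseq_rcons => /andP[_ /eqP <-]; rewrite -wE5.
    have n0 : rcons w3 p <> [::] by case: (w3).
    have sw' : seg (@adj G) (rcons w3 p ++ p' :: w4) z z' by rewrite -wE'.
    case: (seg_catE n0 _ sw') => // p2 [? [s3 _ _]]; have [? /eqP] := seg_lastE s3.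
    by rewrite eqseq_rcons => /andP[_ /eqP pE]; rewrite {2}pE.
  by exists (rcons w3 p), z, p; split=> //; rewrite adj_sym.
have [c1 [zc nvc hc]] : exists c1, [/\ adj z c1, ~~ adj v c1 & c1 = u \/ c1 \in w].
  case: w2 wE => [|z2 w2] wE.
    exists u; split; [| |by left].
      suff -> : z = z' by [].
      by move: sw; rewrite wE => /and3P[_ _ /eqP].
    by apply: (linked_nadj rc lu); rewrite mem_cat mem_head orbT.
  rewrite wE in sw; have [_ zz2 s2] := seg_consE sw.
  exists z2; split=> //; last by right; rewrite wE !inE eqxx orbT.
  apply/negP => vz2; have := wmin (z2 :: w2) z2 z' _ _ s2 vz2 zu.
  rewrite wE /= ltnn => /(_ _ _)/wrap[].
  - by move=> a aw; rewrite inE aw orbT.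
  - by move: uw; rewrite wE => /andP[].
  - by [].
exact: (star_exit rc lu erefl hF hFu hw zw vz zc nvc hc hvu).
Qed.

End Flip.

Section Contradiction.
Variables (G : sgraph) (v u : G) (X Y w : seq G) (z z' : G).
Hypotheses (rc : rooted_cycle (@hadj G) v (X ++ u :: Y) w) (uw : uniq w).
Hypotheses (sw : seg (@adj G) w z z') (vz : adj v z) (zu : adj z' u).
Hypothesis wmin : forall w' a b, {subset w' <= w} -> uniq w' -> seg (@adj G) w' a b ->
  adj v a -> adj b u -> size w <= size w'.

Let lu : linked w v u. Proof. by exists w, z, z'; split. Qed.

Let wmin' w' a b : {subset w' <= rev w} -> uniq w' -> seg (@adj G) w' a b ->
  adj u a -> adj b v -> size (rev w) <= size w'.
Proof.
move=> sub uw' sw' ua bv; rewrite size_rev -(size_rev w').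
apply: (wmin (a := b) (b := a)).
- by move=> x; rewrite mem_rev => /sub; rewrite mem_rev.
- by rewrite rev_uniq.
- exact: seg_rev (@adj_sym G) sw'.
- by rewrite adj_sym.
- by rewrite adj_sym.
Qed.

Let rc_rev e x T : rooted_cycle e x T w -> rooted_cycle e x T (rev w).
Proof.
case=> *; split=> //; first by move=> a; rewrite mem_rev; auto.
by apply: maximal_cycle_mem (_ : maximal_cycle e (x :: T) w) => // a; rewrite mem_rev.
Qed.

Let flip_exit e0 (F : {set G}) : rooted_cycle e0 v (X ++ u :: Y) w ->
  (forall x y, e0 x y -> hadj x y || (x \in F) && (y \in F)) ->
  (forall f, f \in F -> f = v \/ e0 v f) -> (heavy u -> heavy v) ->
  exists e (B : {set G}), [/\ rooted_cycle e u (Y ++ v :: X) (rev w), u \in B,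
   [/\ subrel e0 e, forall x y, e x y -> e0 x y || (x \in B) && (y \in B) &
       forall f, f \in B -> f = u \/ e u f] & heavy_exit e u v (Y ++ X)].
Proof.
move=> rc0 hF hFu huv; apply: (side_exit (F := F) (z := z') (z' := z)) => //.
- exact: rc_rev (rc_flip rc0 lu).
- by rewrite rev_uniq.
- exact: seg_rev (@adj_sym G) sw.
- by rewrite adj_sym.
- by rewrite adj_sym.
Qed.

(* The heavy exits obtained from [v] and from [u] are traversed in the same direction,
   so that exchanging two edges of the cycle for the edge joining the exits gives a
   spanning path from [v] to [u]. *)
Lemma no_linked_cycle : False.
Proof.
have u0 : uniq (X ++ Y) := c0_uniq rc erefl.
have c0m : forall x, (x \in X ++ Y) = (x \in X ++ u :: Y) && (x != u) := c0_mem rc erefl.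
have vX x : x \in X ++ Y -> x != v.
  by rewrite c0m => /andP[/(rc_vNT rc)].
have [hu|lightu] := boolP (heavy u).
  have [||//|e [B [rcB _ [sub _ _] [a [ac _ _ hb nub]]]]] :=
    side_exit (F := set0) rc uw sw vz zu wmin.
  - by move=> x y ->.
  - by move=> f; rewrite inE.
  have /negP := nub; apply; apply: sub; apply: heavy_hadj => //.
  by move: ac; rewrite -mem_next c0m eq_sym => /andP[].
have [hv|lightv] := boolP (heavy v).
  have [||//|e [B [rcB _ [sub _ _] [a [ac _ _ hb nub]]]]] := flip_exit (F := set0) rc.
  - by move=> x y ->.
  - by move=> f; rewrite inE.
  have /negP := nub; apply; apply: sub; apply: heavy_hadj => //.
  by rewrite eq_sym vX // -(perm_mem (permEl (perm_catC Y X))) mem_next.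
(* With both ends light the comparison of their heaviness is vacuous on each side. *)
have [||/(negP lightv)//|e1 [B1 [rc1 _ [sub1 hB1 hv1] [a1 [ac1 va1 vb1 hb1 _]]]]] :=
    side_exit (F := set0) rc uw sw vz zu wmin.
- by move=> x y ->.
- by move=> f; rewrite inE.
have [||/(negP lightu)//|e2 [B2 [rc2 _ [sub2 _ _] [a2 [ac2 ua2 ub2 hb2 nvb2]]]]] :=
    flip_exit (F := B1) rc1.
- exact: hB1.
- exact: hv1.
have uYX : uniq (Y ++ X) by rewrite uniq_catC.
have nE : next (Y ++ X) =1 next (X ++ Y).
  by move=> x; rewrite -(next_rot (size Y) uYX) rot_size_cat.
rewrite nE in ub2 hb2 nvb2; set b1 := next _ a1 in vb1 hb1.
set b2 := next _ a2 in ub2 hb2 nvb2.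
have b12 : b1 != b2 by apply: contraNneq nvb2 => <-; apply: sub2.
have eb : e2 b2 b1 by apply/sub2/sub1/heavy_hadj; rewrite // eq_sym.
have luv : linked (rev w) u v.
  exists (rev w), z', z; split; rewrite ?rev_uniq //.
  - exact: seg_rev (@adj_sym G) sw.
  - by rewrite adj_sym.
  - by rewrite adj_sym.
have rc2v := rc_flip rc2 luv; have lvu := linked_sym luv.
have [xl [yh [[sX sY xyh] _]]] := linked_nbrs rc2v lvu erefl.
have bc1 : b1 \in X ++ Y by rewrite mem_next.
have [Z [x1 [x0 [sZ bx1 x0b pZ nZ]]]] := c0_rot rc2v lvu erefl sX sY xyh bc1.
have uZ : uniq (b1 :: Z) by rewrite (perm_uniq pZ).
have aE : a1 = x0.
  apply: (can_inj (prev_next u0)); rewrite -/b1 nZ.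
  have [Z' ZE] := seg_lastE sZ; have := next_last uZ; rewrite {2}ZE last_rcons => ->.
  by [].
have a2L : a2 \in b1 :: Z by rewrite (perm_mem pZ) mem_cat orbC -mem_cat.
have a2x : a2 != x0.
  by apply: contraNneq b12 => E; rewrite /b1 /b2 aE E.
have sL := seg_cons bx1 sZ.
have b2E : b2 = next ((b1 :: Z) ++ [::]) a2 by rewrite cats0 -nZ.
have uZ0 : uniq ((b1 :: Z) ++ [::]) by rewrite cats0.
have [U [V [LE sU sV]]] := seg_split_next uZ0 sL a2L a2x b2E.
(* From [a1] backwards to [b2], across the heavy pair to [b1], then forwards to [a2]. *)
apply: (no_spanning_path rc2v lvu erefl (q := rev V ++ U) (a := x0) (b := a2)).
- apply: perm_trans pZ; rewrite LE; perm_by_count.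
- by apply: seg_cat (seg_rev (rc_sym rc2) sV) eb sU.
- by rewrite -aE; apply: sub2.
- by rewrite (rc_sym rc2).
Qed.

End Contradiction.

(** * A longest cycle through the heavy vertices *)

Section Existence.
Variable G : sgraph.
Hypothesis G2 : k_connected 2 G.
Implicit Types (h x y z u v : G) (C w p : seq G).

Lemma avoiding_path h x y : x != h -> y != h ->
  exists p, [/\ path (@adj G) x p, last x p = y, uniq (x :: p) & h \notin x :: p].
Proof.
move=> xh yh; have [_ /(_ [set h])] := G2; rewrite cards1 => /(_ isT) conn.
have xS : x \in ~: [set h] by rewrite !inE.
have yS : y \in ~: [set h] by rewrite !inE.
have /connectP[p pP yE] := conn (exist _ x xS) (exist _ y yS).
have pP' : path (@adj G) (val (exist (fun a => a \in ~: [set h]) x xS)) (map val p).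
  by rewrite path_map.
rewrite /= in pP'.
have lE : last x (map val p) = y by rewrite (last_map val p (exist _ x xS)) -yE.
have hp : h \notin x :: map val p.
  rewrite inE eq_sym negb_or xh; apply/mapP => -[a _ hE].
  by have := valP a; rewrite -hE !inE eqxx.
case/shortenP: pP' lE hp => p' pP' up' sub lE hp; exists p'; split=> //.
by apply: contra hp; rewrite !inE => /orP[->//|/sub ->]; rewrite orbT.
Qed.

Lemma card_gt2 : 2 < #|G|. Proof. by case: G2. Qed.

Lemma other_vertex x y : exists z, z != x /\ z != y.
Proof.
have : 0 < #|~: [set x; y]|.
  have := cardsC [set x; y]; have := card_gt2; have := cards2 x y.
  by case: eqP => _ -> /=; lia.
by case/card_gt0P=> z; rewrite !inE negb_or => /andP[]; exists z.
Qed.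

Lemma other_nbr h h2 : h != h2 -> exists2 x, adj h x & x != h2.
Proof.
move=> hh; have [t [th th2]] := other_vertex h h2.
have [p [pP lp _ hp]] := avoiding_path hh th2.
case: p pP lp hp => [|x p] /=; first by move=> _ E; rewrite E eqxx in th.
by case/andP=> hx _ _; rewrite !inE => /norP[_ /norP[]]; exists x; rewrite // eq_sym.
Qed.

Lemma edge_in_cycle h1 h2 : hadj h1 h2 -> exists c a b,
  [/\ seg (@hadj G) c a b, hadj b a, uniq c, 2 < size c & (h1 \in c) && (h2 \in c)].
Proof.
move=> h12; have nh := hadj_neq h12; have [x hx xh2] := other_nbr nh.
have xh : x != h1 by rewrite eq_sym adj_neq.
have [p [pP lp up hp]] : exists p, [/\ path (@adj G) x p, last x p = h2, uniq (x :: p) & h1 \notin x :: p].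
  by apply: avoiding_path => //; rewrite eq_sym.
exists (h1 :: x :: p), h1, h2; split.
- apply: seg_cons (adj_hadj hx) _; rewrite -lp.
  by apply: path_seg; apply: sub_path pP; apply: adj_hadj.
- by rewrite hadj_sym.
- by rewrite cons_uniq hp.
- by case: p lp {pP up hp} => // E; rewrite -E eqxx in xh2.
- by rewrite mem_head inE -lp mem_last orbT.
Qed.

(** Three or more heavy vertices form a closure cycle in any order; fewer are covered by one closure
    pair, which lies on a cycle by 2-connectedness. *)
Lemma heavy_cycle : exists c a b,
  [/\ seg (@hadj G) c a b, hadj b a, uniq c, 2 < size c & forall x, heavy x -> x \in c].
Proof.
pose l := enum [set x : G | heavy x].
have lP x : heavy x = (x \in l) by rewrite mem_enum inE.
have ul : uniq l := enum_uniq _.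
have of_edge h1 h2 : hadj h1 h2 -> {subset l <= [:: h1; h2]} -> exists c a b,
    [/\ seg (@hadj G) c a b, hadj b a, uniq c, 2 < size c & forall x, heavy x -> x \in c].
  move=> /edge_in_cycle[c [a [b [h1' h2' h3 h4 /andP[c1 c2]]]]] sub.
  exists c, a, b; split=> // x; rewrite lP => /sub; rewrite !inE.
  by case/orP=> /eqP->.
have nbr h : exists x, hadj h x.
  have [h2 [h2h _]] := other_vertex h h; rewrite eq_sym in h2h.
  by have [x hx _] := other_nbr h2h; exists x; apply: adj_hadj.
case lE : l of_edge => [|h1 [|h2 [|h3 l']]] of_edge.
- have [h _] : exists h : G, true.
    by have /card_gt0P[h _] : 0 < #|G| by have := card_gt2; lia.
  by have [x hx] := nbr h; apply: (of_edge h x).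
- have [x hx] := nbr h1; apply: (of_edge h1 x) => // y; rewrite !inE => ->//.
- apply: (of_edge h1 h2) => //; move: ul; rewrite lE /= inE => /andP[nh _].
  by apply: heavy_hadj => //; rewrite lP lE !inE eqxx ?orbT.
have hl : all (@heavy G) l by apply/allP => x; rewrite -lP.
have seg_all c a : uniq (a :: c) -> all (@heavy G) (a :: c) ->
    seg (@hadj G) (a :: c) a (last a c).
  elim: c a => [|b c IH] a; first by move=> _ _; apply: seg1.
  move=> /= /andP[nab ubc] /and3P[ha hb hc].
  apply: seg_cons (IH b ubc _); last by rewrite /= hb hc.
  by apply: heavy_hadj => //; move: nab; rewrite inE negb_or => /andP[].
rewrite lE in ul hl; have sl := seg_all _ _ ul hl.
exists l, h1, (last h1 [:: h2, h3 & l']); split; rewrite ?lE //; last by move=> x; rewrite lP lE.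
have : last h2 (h3 :: l') \in l by rewrite lE inE mem_last orbT.
rewrite -lP => hh; apply: heavy_hadj => //; last by case/andP: hl.
have /andP[nh _] := ul; rewrite eq_sym; apply: contraNneq nh => {1}->.
exact: (mem_last h2 (h3 :: l')).
Qed.

Definition good_cycle n := [exists t : n.-tuple G,
  [&& 2 < n, uniq t, cycle (@adj G) t & [forall x, heavy x ==> (x \in t)]]].

Lemma good_cycleP n : reflect (exists C : seq G, [/\ size C = n, 2 < n, uniq C,
  cycle (@adj G) C & forall x, heavy x -> x \in C]) (good_cycle n).
Proof.
apply: (iffP existsP) => [[t /and4P[n2 ut ct /forallP ht]]|[C [sC n2 uC cC hC]]].
  by exists t; rewrite size_tuple; split=> // x; apply/implyP.
have sC' : size C == n by rewrite sC.
by exists (Tuple sC'); rewrite n2 /= uC cC /=; apply/forallP => x; apply/implyP/hC.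
Qed.

Lemma good_cycle_hadj c a b : seg (@hadj G) c a b -> hadj b a -> uniq c -> 2 < size c ->
  (forall x, heavy x -> x \in c) -> exists2 n, good_cycle n & size c <= n.
Proof.
move=> sc ba uc c2 hc; have [c' [a' [b' [sc' ba' uc' sub]]]] := hadj_cycle sc ba uc c2.
have le := uniq_leq_size uc sub; exists (size c') => //.
apply/good_cycleP; exists c'; split=> //; first exact: leq_trans le.
- exact: seg_cycle sc' ba'.
- by move=> x /hc/sub.
Qed.

Lemma longest_good_cycle : exists C, [/\ 2 < size C, uniq C, cycle (@adj G) C,
  forall x, heavy x -> x \in C & forall n, good_cycle n -> n <= size C].
Proof.
have ex : exists n, good_cycle n.
  have [c [a [b [h1 h2 h3 h4 h5]]]] := heavy_cycle.
  by have [n hn _] := good_cycle_hadj h1 h2 h3 h4 h5; exists n.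
have bound n : good_cycle n -> n <= #|G|.
  by case/good_cycleP=> C [<- _ uC _ _]; rewrite -(card_uniqP uC) max_card.
case: (ex_maxnP ex bound) => n /good_cycleP[C [sC n2 uC cC hC]] mx.
by exists C; rewrite sC.
Qed.

Lemma first_hit C z p : z \notin C -> path (@adj G) z p -> last z p \in C ->
  exists w v, [/\ path (@adj G) z w, all (fun x => x \notin C) (z :: w),
    adj (last z w) v, v \in C & v \in p].
Proof.
move=> zC pP lC; have lp : last z p \in p.
  by have := mem_last z p; rewrite inE => /orP[/eqP E|//]; rewrite E (negbTE zC) in lC.
have [|w [v [p2 [pE aw vC]]]] := split_prefix (P := fun x => x \notin C) lp.
  by rewrite negbK.
move: pP; rewrite pE cat_path /= => /and3P[wP wv _].
exists w, v; split=> //; [by rewrite /= zC|exact: negbNE|].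
by rewrite mem_cat mem_head orbT.
Qed.

Definition ear C v u w := [&& uniq w, all (fun x => x \notin C) w &
  [exists a, [exists b, [&& seg (@adj G) w a b, adj v a & adj b u]]]].

(** Of two paths from [z] to [C], the second avoids the vertex where the first one arrives; glued at
    [z] and shortened, they give the ear. *)
Lemma ear_exists C z : 1 < size C -> uniq C -> z \notin C ->
  exists v u w, [/\ v \in C, u \in C, v != u & ear C v u w].
Proof.
case: C => [|c1 [|c2 C]] // _ uC zC.
have c12 : c1 != c2 by move: uC; rewrite /= inE => /andP[/norP[]].
have nz c : c \in c1 :: c2 :: C -> z != c by move=> cC; apply: contraNneq zC => ->.
have m1 : c1 \in c1 :: c2 :: C by rewrite mem_head.
have m2 : c2 \in c1 :: c2 :: C by rewrite !inE eqxx orbT.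
have [p1 [p1P l1 _ _]] := avoiding_path (nz _ m2) c12.
have l1C : last z p1 \in c1 :: c2 :: C by rewrite l1.
have [w1 [v [w1P a1 wv vC _]]] := first_hit zC p1P l1C.
have [c cC cv] : exists2 c, c \in c1 :: c2 :: C & c != v.
  by have [<-|] := eqVneq c1 v; [exists c2; rewrite // eq_sym | exists c1].
have [p2 [p2P l2 _ vp2]] := avoiding_path (nz _ vC) cv.
have l2C : last z p2 \in c1 :: c2 :: C by rewrite l2.
have [w2 [u [w2P a2 wu uC2 up2]]] := first_hit zC p2P l2C.
have vu : v != u by apply: contraNneq vp2 => ->; rewrite inE up2 orbT.
exists v, u; pose s := rev (z :: w1) ++ w2.
have sP : seg (@adj G) s (last z w1) (last z w2).
  have s1 := seg_rev (@adj_sym G) (path_seg w1P).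
  rewrite /s; case: (w2) w2P => [|b w3] /=; first by rewrite cats0.
  by case/andP=> zb w3P; apply: seg_cat s1 zb (path_seg w3P).
have sC : all (fun x => x \notin c1 :: c2 :: C) s.
  by rewrite all_cat all_rev a1; case/andP: a2.
have [p sE] := seg_headE sP; rewrite sE in sP sC.
have /and3P[_ pP /eqP lp] := sP.
case/shortenP: pP lp => p' pP' up' sub lp; exists (last z w1 :: p'); split=> //.
apply/and3P; split=> //.
  apply/allP => x; rewrite inE => /orP[/eqP->|/sub xp]; apply: (allP sC).
    exact: mem_head.
  by rewrite inE xp orbT.
apply/existsP; exists (last z w1); apply/existsP; exists (last z w2).
by rewrite -lp path_seg //= [adj v _]adj_sym wv lp.
Qed.

Lemma shortest_ear C v u w : ear C v u w -> exists w', ear C v u w' /\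
  forall w'', ear C v u w'' -> size w' <= size w''.
Proof.
move=> ew; have ex : exists n, [exists t : n.-tuple G, ear C v u t].
  by exists (size w); apply/existsP; exists (in_tuple w).
case: (ex_minnP ex) => n /existsP[t et] mn; exists t; split=> // w'' ew''.
by rewrite size_tuple; apply: mn; apply/existsP; exists (in_tuple w'').
Qed.

End Existence.

Theorem theorem11 (G : sgraph)
  (G_2conn : k_connected 2 G)
  (G_heavy : family_f_heavy (fun H => H = claw \/ H = wounded) G) :
  hamiltonian G.
Proof.
have Gclaw : f_heavy claw G by apply: G_heavy; left.
have Gw : f_heavy wounded G by apply: G_heavy; right.
have [C [C2 uC cC hC maxC]] := longest_good_cycle G_2conn.
have [/forallP span|] := boolP [forall x, x \in C].
  by exists C; split=> //; rewrite /ucycle cC.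
rewrite negb_forall => /existsP[z0 z0C].
have [v [u [w0 [vC uC' vu ew0]]]] := ear_exists G_2conn (ltnW C2) uC z0C.
have [w [/and3P[uw aw /existsP[z /existsP[z' /and3P[sw vz zu]]]] wmin]] := shortest_ear ew0.
have [i T rE] := rot_to vC.
have memT x : (x \in v :: T) = (x \in C) by rewrite -rE mem_rot.
have uT : u \in T by have := memT u; rewrite inE uC' eq_sym (negbTE vu).
have [X [Y TE]] := mem_split uT.
have cyc : cycle (@adj G) (v :: T) by rewrite -rE rot_cycle.
have uvT : uniq (v :: T) by rewrite -rE rot_uniq.
have sizeT : size (v :: T) = size C by rewrite -rE size_rot.
have rc : rooted_cycle (@hadj G) v (X ++ u :: Y) w.
  rewrite -TE; have T0 : T <> [::] by move=> T0; rewrite -sizeT T0 in C2.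
  have [sT lT] := cycle_seg cyc.
  have [sT' vT] : seg (@adj G) T (head v T) (last v T) /\ adj v (head v T).
    case: (T) T0 sT => // a t _ /seg_consE[_ va st].
    by split.
  split=> //; first exact: hadj_sym.
  - by rewrite -ltnS -[(size T).+1]/(size (v :: T)) sizeT.
  - by rewrite adj_sym.
  - by move=> x /hC; rewrite memT.
  - by move=> x xw; rewrite memT; apply: (allP aw).
  move=> c a b sc ba uc sub _ x xc; apply/negPn/negP => xT.
  (* A closure cycle with a further vertex would yield a cycle of G through all heavy vertices that
     is longer than [C]. *)
  have lt : size C < size c.
    rewrite -sizeT; apply: (@uniq_leq_size _ (x :: v :: T)); first by rewrite cons_uniq xT.
    by move=> y; rewrite inE => /orP[/eqP->|/sub].
  have [||n gn cn] := good_cycle_hadj sc ba uc.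
  - exact: leq_trans C2 (ltnW lt).
  - by move=> y /hC; rewrite -memT => /sub.
  by have := leq_trans lt (leq_trans cn (maxC _ gn)); rewrite ltnn.
exfalso; apply: (no_linked_cycle rc uw sw vz zu) => w' a b sub uw' sw' va bu.
apply: wmin; apply/and3P; split=> //.
  by apply/allP => x /sub xw; apply: (allP aw).
by apply/existsP; exists a; apply/existsP; exists b; rewrite sw' va bu.
Qed.
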